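(* Let $k,m$ be positive integers and let $\mathcal F_1$ and $\mathcal F_2$ be intersecting families of $k$-multisets with elements from $[m]$. If $m > \frac{1}{2}(1+\sqrt5)k + 1$, then \[|\mathcal F_1 \cup \mathcal F_2| \leq \binom{m+k-2}{k-1} + \binom{m+k-3}{k-1}.\] Equality holds if and only if there exists a $2$-set $\{x,y\} \subset [m]$ such that $\mathcal F_1 \cup \mathcal F_2$ consists of all $k$-multisets of $[m]$ that intersect $\{x,y\}$.
   Context: A $k$-multiset of $[m]=\{1,\dots,m\}$ is a multiset of cardinality $k$ (counting repetitions) with elements from $[m]$; $\mathrm{m}(i,A)$ denotes the multiplicity of $i$ in $A$. The intersection of multisets $A,B$ is the multiset $C$ with $\mathrm{m}(i,C)=\min\{\mathrm{m}(i,A),\mathrm{m}(i,B)\}$ (a set is regarded as a multiset with all multiplicities one). A family is intersecting if every two members have nonempty intersection. *)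

(* Defs.v *)
From mathcomp Require Import all_boot all_order all_algebra finmap multiset.

Set Implicit Arguments.
Unset Strict Implicit.
Unset Printing Implicit Defensive.

Local Open Scope fset_scope.
Local Open Scope mset_scope.

(* [size A] counts the elements of the multiset A with repetitions,
   whereas [#|A|] would count its distinct elements only.
   The ground set {1, ..., m} is represented by 'I_m. *)
Definition kmultiset (k m : nat) (A : {mset 'I_m}) : bool := size A == k.

(* There are finitely many k-multisets over 'I_m, so every family of them
   is an element of {fset {mset 'I_m}}. *)
Definition kmultiset_family (k m : nat) (F : {fset {mset 'I_m}}) : Prop :=
  forall A, A \in F -> kmultiset k A.

Definition intersecting (m : nat) (F : {fset {mset 'I_m}}) : Prop :=
  forall A B, A \in F -> B \in F -> A `&` B != mset0.

(* Main.v *)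
(* Replacing every multiset by the subsets of an (m+k-1)-element set whose trace
   on the first m points is its support preserves cardinalities (both sides
   count 'C(k-1, |S|-1) members over a support S) and turns intersecting
   families of k-multisets into intersecting families of k-sets, so it suffices
   to bound |A :|: B| for intersecting families A, B of k-subsets of {1..N},
   N = m+k-1.

   Compress A towards small elements and B, simultaneously, towards large ones:
   compressing the two families in opposite directions never shrinks A :|: B.
   For the compressed A, let a0 (ay) be the number of its members that avoid 1
   and N (avoid 1 and contain N), and mx the number of k-sets that contain 1,
   avoid N and are not in A. Every member F of A has more than j elements among
   the first 2j+1 points, for some j; splitting according to the first such j
   and double counting gives
     (N-k-2) a0 <= (k-1) mx    and    (N-k-1) ay <= (k-2) a0.
   When (N-k)^2 > N k, which is the golden ratio condition, these yield
   ay + a0 < mx unless a0 = ay = 0. Together with the mirror images for B, this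
   says that A :|: B has fewer members than the family of all k-sets that meet
   {1, N}, unless A and B are stars. Finally, stars of maximal union cannot be
   created by a compression from families that were not already stars, because
   a Kneser graph is connected. *)
Require Import Defs.
From mathcomp Require Import all_boot all_order all_algebra finmap multiset.
From mathcomp Require Import perm zify lra.

Set Implicit Arguments.
Unset Strict Implicit.
Unset Printing Implicit Defensive.

(** * Double counting *)

(** Removing [C] turns the interval between [C] and [E] into the draws of [k - #|C|] points from
    [E :\: C]. The degrees in the double counts for compressed families are sizes of such
    intervals. *)
Lemma card_set_interval (T : finType) (C E : {set T}) (k : nat) :
  C \subset E -> #|C| <= k ->
  #|[set X : {set T} | [&& C \subset X, X \subset E & #|X| == k]]|
    = 'C(#|E| - #|C|, k - #|C|).
Proof.
move=> sCE leCk.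
have cED : #|E :\: C| = #|E| - #|C| by rewrite cardsD (setIidPr sCE).
rewrite -cED -cards_draws.
set D := [set A : {set T} | A \subset E :\: C & _].
have DP Y : Y \in D -> [/\ Y \subset E, [disjoint Y & C] & #|Y| = k - #|C|].
  by rewrite inE subsetD => /andP[/andP[-> ->] /eqP->].
rewrite -(@card_in_imset _ _ (setU C) D); last first.
  move=> Y Z /DP[_ dY _] /DP[_ dZ _] /setP eYZ; apply/setP=> i.
  have := eYZ i; rewrite !inE.
  have := disjointFl dY (x := i); have := disjointFl dZ (x := i).
  by case: (i \in C) => //= H1 H2; rewrite ?H1 ?H2.
apply: eq_card => X; rewrite inE; apply/and3P/imsetP.
  case=> sCX sXE /eqP cX; exists (X :\: C); last first.
    apply/setP=> i; rewrite !inE; have := subsetP sCX i.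
    by case: (i \in C) => // ->.
  by rewrite inE setSD //= cardsD (setIidPr sCX) cX.
case=> Y /DP[sYE dY cY] ->; split; first exact: subsetUl.
  by rewrite subUset sCE.
by rewrite cardsU setIC (disjoint_setI0 dY) cards0 cY subn0 subnKC.
Qed.

Lemma double_count (S T : finType) (X : {set S}) (Y : {set T})
    (e : S -> T -> bool) (a b : nat) :
    (forall x, x \in X -> a <= #|[set y in Y | e x y]|) ->
    (forall y, y \in Y -> #|[set x in X | e x y]| <= b) ->
  #|X| * a <= #|Y| * b.
Proof.
move=> ha hb.
have -> : #|X| * a = \sum_(x in X) a by rewrite sum_nat_const.
have -> : #|Y| * b = \sum_(y in Y) b by rewrite sum_nat_const.
apply: leq_trans (leq_sum _ ha) _; apply: leq_trans (leq_sum _ hb).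
have E1 x : #|[set y in Y | e x y]| = \sum_(y in Y) e x y.
  by rewrite -sum1dep_card big_mkcondr; apply: eq_bigr => y _; case: (e x y).
have E2 y : #|[set x in X | e x y]| = \sum_(x in X) e x y.
  by rewrite -sum1dep_card big_mkcondr; apply: eq_bigr => x _; case: (e x y).
by rewrite (eq_bigr _ (fun x _ => E1 x)) exchange_big (eq_bigr _ (fun y _ => E2 y)).
Qed.

(** Sum the fibrewise inequalities over [j < N]. Members of [Y] with [g y >= N] drop out of the
    right-hand sum, which errs in the harmless direction. *)
Lemma leq_card_fibers (S T : finType) (X : {set S}) (Y : {set T})
    (f : S -> nat) (g : T -> nat) (a b N : nat) :
    (forall x, x \in X -> f x < N) ->
    (forall j, a * #|[set x in X | f x == j]| <= b * #|[set y in Y | g y == j]|) ->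
  a * #|X| <= b * #|Y|.
Proof.
move=> fN hj.
have E (U : finType) (Z : {set U}) (h : U -> nat) :
    \sum_(j < N) #|[set x in Z | h x == j]| = \sum_(x in Z) (h x < N).
  have E1 (j : 'I_N) : #|[set x in Z | h x == j]| = \sum_(x in Z) (h x == j).
    by rewrite -sum1dep_card big_mkcondr; apply: eq_bigr => x _; case: eqP.
  rewrite (eq_bigr _ (fun j _ => E1 j)) exchange_big; apply: eq_bigr => x _ /=.
  case: ltnP => hx.
    rewrite (bigD1 (Ordinal hx)) //= eqxx big1 // => j.
    by rewrite -val_eqE /= eq_sym => /negPf->.
  by rewrite big1 // => j _; rewrite gtn_eqF // (leq_trans _ hx).
have -> : #|X| = \sum_(j < N) #|[set x in X | f x == j]|.
  by rewrite E -sum1_card; apply: eq_bigr => x /fN->.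
apply: (@leq_trans (b * \sum_(j < N) #|[set y in Y | g y == j]|)).
  by rewrite !big_distrr leq_sum.
rewrite leq_mul2l E -sum1_card leq_sum ?orbT // => y _; exact: leq_b1.
Qed.

(** * Compressions *)

Definition uniform (T : finType) (k : nat) (A : {set {set T}}) : Prop :=
  forall F, F \in A -> #|F| = k.

Definition intersecting_family (T : finType) (A : {set {set T}}) : Prop :=
  forall F G, F \in A -> G \in A -> F :&: G != set0.

Definition swap (T : finType) (x y : T) (F : {set T}) : {set T} :=
  [set i | tperm x y i \in F].

Lemma swapK (T : finType) (x y : T) : involutive (swap x y).
Proof. by move=> F; apply/setP=> i; rewrite !inE tpermK. Qed.

Lemma swapC (T : finType) (x y : T) : swap x y =1 swap y x.
Proof. by move=> F; apply/setP=> i; rewrite !inE tpermC. Qed.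

Lemma in_swapl (T : finType) (x y : T) (F : {set T}) : (x \in swap x y F) = (y \in F).
Proof. by rewrite inE tpermL. Qed.

Lemma in_swapr (T : finType) (x y : T) (F : {set T}) : (y \in swap x y F) = (x \in F).
Proof. by rewrite inE tpermR. Qed.

Lemma in_swapD (T : finType) (x y i : T) (F : {set T}) :
  i != x -> i != y -> (i \in swap x y F) = (i \in F).
Proof. by move=> ix iy; rewrite inE tpermD // eq_sym. Qed.

Lemma card_swap (T : finType) (x y : T) (F : {set T}) : #|swap x y F| = #|F|.
Proof.
rewrite -(card_imset F (@perm_inj _ (tperm x y))); apply: eq_card => i.
by rewrite inE -{2}(tpermK x y i) mem_imset //; apply: perm_inj.
Qed.

Lemma swap_same (T : finType) (x y : T) (F : {set T}) :
  (x \in F) = (y \in F) -> swap x y F = F.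
Proof.
move=> exy; apply/setP=> i; rewrite inE.
by case: tpermP => [->|->|].
Qed.

Lemma setI_swap (T : finType) (x y : T) (F G : {set T}) :
  swap x y F :&: swap x y G = swap x y (F :&: G).
Proof. by apply/setP=> i; rewrite !inE. Qed.

Lemma swap0 (T : finType) (x y : T) : swap x y set0 = set0.
Proof. by apply/setP=> i; rewrite !inE. Qed.

(* The compression replacing y by x, described through membership: of the
   pair {F, swap x y F} it keeps as many members as before, preferring the
   one that contains x. *)
Definition shift (T : finType) (x y : T) (A : {set {set T}}) : {set {set T}} :=
  [set F : {set T} | if (x \in F) && (y \notin F) then (F \in A) || (swap x y F \in A)
           else if (y \in F) && (x \notin F) then (F \in A) && (swap x y F \in A)
           else F \in A].

Lemma shift_uniform (T : finType) (x y : T) (k : nat) (A : {set {set T}}) :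
  uniform k A -> uniform k (shift x y A).
Proof.
move=> uA F; rewrite inE; case: ifP => _; last by case: ifP => _ => [/andP[]|] /uA.
by case/orP=> /uA //; rewrite card_swap.
Qed.

(** A new member [F] contains [x], and its swap lies in [A]. If [G] contains [x] too, they meet
    there; otherwise the swap of [G] also lies in [A], so the two swaps meet, and hence so do [F]
    and [G]. *)
Lemma shift_intersecting (T : finType) (x y : T) (A : {set {set T}}) :
  intersecting_family A -> intersecting_family (shift x y A).
Proof.
move=> iA.
have key F G : F \in shift x y A -> G \in shift x y A ->
    F \notin A -> F :&: G != set0.
  rewrite !inE => hF hG nF.
  have /andP[xF yF] : (x \in F) && (y \notin F).
    by move: hF; rewrite (negPf nF) /=; case: (_ && _) => //; case: (_ && _).
  rewrite xF yF (negPf nF) /= in hF.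
  case xG : (x \in G); first by apply/set0Pn; exists x; rewrite inE xF.
  have hsG : swap x y G \in A.
    move: hG; rewrite xG /=; case yG: (y \in G) => /=; first by case/andP.
    by rewrite swap_same ?xG ?yG.
  apply: contraNneq (iA _ _ hF hsG) => e0.
  by rewrite setI_swap e0 swap0.
move=> F G hF hG.
case: (boolP (F \in A)) => FA; last exact: key.
case: (boolP (G \in A)) => GA; first exact: iA.
by rewrite setIC; exact: key.
Qed.

(** On a pair [{F, swap x y F}] the two shifts prefer different members. If both families meet the
    pair, the new union contains all of it; if only one does, its number of members there is kept.
    So [swap x y] injects the sets lost by the union into those gained. *)
Lemma leq_card_setU_shift (T : finType) (x y : T) (A B : {set {set T}}) :
  #|A :|: B| <= #|shift x y A :|: shift y x B|.
Proof.
set U := A :|: B; set V := _ :|: _.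
rewrite -[#|U|](cardsID V) -[#|V|](cardsID U) setIC leq_add2l.
rewrite -(card_imset _ (inv_inj (@swapK _ x y))); apply: subset_leq_card.
apply/subsetP=> _ /imsetP[F FUV ->]; move: FUV; rewrite !inE.
rewrite !(swapC y x) !swapK ?tpermL ?tpermR.
case xF: (x \in F); case yF: (y \in F) => /=.
- by rewrite swap_same ?xF ?yF // andNb.
- by case: (F \in A); case: (F \in B) => //=;
    case: (swap x y F \in A); case: (swap x y F \in B).
- by case: (F \in A); case: (F \in B) => //=;
    case: (swap x y F \in A); case: (swap x y F \in B).
- by rewrite swap_same ?xF ?yF // andNb.
Qed.

Lemma sum_swap_lt (T : finType) (x y : T) (w : T -> nat) (F : {set T}) :
  w x < w y -> x \in F -> y \notin F ->
  \sum_(i in F) w i < \sum_(i in swap x y F) w i.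
Proof.
move=> wxy xF yF.
have xy : x != y by apply: contraNneq yF => <-.
rewrite (bigD1 x) //= [ltnRHS](bigD1 y) ?in_swapr //=.
rewrite (eq_bigl (fun i => (i \in swap x y F) && (i != y))) ?ltn_add2r // => i.
case: (eqVneq i x) => [->|ix]; first by rewrite in_swapl (negPf yF) andbF.
case: (eqVneq i y) => [->|iy]; first by rewrite (negPf yF) andbF.
by rewrite in_swapD // andbT.
Qed.

(** The lost members are exactly the swaps of the new ones, and each of these exchanges trades [y]
    for the lighter [x]. The total weight thus serves as a termination measure for repeated
    compression. *)
Lemma shift_weight (T : finType) (x y : T) (w : T -> nat) (A : {set {set T}}) :
  w x < w y -> shift x y A != A ->
  \sum_(F in shift x y A) \sum_(i in F) w i < \sum_(F in A) \sum_(i in F) w i.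
Proof.
move=> wxy nA; set A' := shift x y A.
have newP F : F \in A' :\: A ->
    [/\ x \in F, y \notin F & swap x y F \in A :\: A'].
  rewrite !inE swapK tpermL tpermR; case: (x \in F); case: (y \in F) => //=;
    by case: (F \in A); case: (swap x y F \in A).
have oldP F : F \in A :\: A' -> swap x y F \in A' :\: A.
  rewrite !inE swapK tpermL tpermR; case: (x \in F); case: (y \in F) => //=;
    by case: (F \in A); case: (swap x y F \in A).
have eI : A :\: A' = swap x y @: (A' :\: A).
  apply/setP=> F; apply/idP/imsetP=> [/oldP FA|[G /newP[_ _ GA] ->] //].
  by exists (swap x y F); rewrite ?swapK.
rewrite [ltnRHS](big_setID A') [ltnLHS](big_setID A) /= setIC ltn_add2l.
rewrite eI big_imset /=; last by move=> F G _ _; apply: (inv_inj (@swapK _ x y)).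
have [F FA] : exists F, F \in A' :\: A.
  apply/set0Pn; apply: contraNneq nA => e0.
  apply/eqP; rewrite -/A' -[LHS](setID A' A) -[RHS](setID A A').
  by rewrite eI e0 imset0 setIC.
rewrite (bigD1 F) //= [ltnRHS](bigD1 F) //= -addSn leq_add //.
  by have [xF yF _] := newP _ FA; apply: sum_swap_lt.
apply: leq_sum => G /andP[/newP[xG yG _] _].
exact/ltnW/sum_swap_lt.
Qed.

(** * Left-compressed families *)

Definition left_shifted (n : nat) (A : {set {set 'I_n}}) : Prop :=
  forall (x y : 'I_n) F, x < y -> F \in A -> x \notin F -> y \in F -> swap x y F \in A.

Definition below (n t : nat) : {set 'I_n} := [set i : 'I_n | i < t].
Arguments below {n} t.

Lemma card_below (n t : nat) : t <= n -> #|@below n t| = t.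
Proof.
move=> tn; have winj : injective (widen_ord tn) by move=> i j [] /val_inj.
rewrite -[RHS]card_ord -cardsT -(card_imset _ winj).
apply: eq_card => i; rewrite inE; apply/idP/imsetP => [it|[j _ ->] //=].
by exists (Ordinal it) => //; apply: val_inj.
Qed.

Lemma below_all (n : nat) (F : {set 'I_n}) : F :&: below n = F.
Proof. by apply/setP=> i; rewrite !inE ltn_ord andbT. Qed.

(* Moving the least element of F outside G to the least element of G outside F
   preserves the domination of F by G. *)
Lemma left_shifted_dominated (n : nat) (A : {set {set 'I_n}}) (F G : {set 'I_n}) :
    left_shifted A -> F \in A -> #|G| = #|F| ->
    (forall t, t <= n -> #|F :&: below t| <= #|G :&: below t|) ->
  G \in A.
Proof.
move=> lA; have [m] := ubnP #|F :\: G|; elim: m F => // m IHm F ltm FA cGF dom.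
have eD : #|F :\: G| = #|G :\: F| by rewrite !cardsD setIC cGF.
have [/eqP|[y0 y0FG]] := set_0Vmem (F :\: G).
  rewrite finset.setD_eq0 => sFG; suff -> : G = F by [].
  by apply/eqP; rewrite eq_sym eqEcard sFG cGF leqnn.
have [x0 x0GF] : exists x, x \in G :\: F.
  by apply/set0Pn; rewrite -card_gt0 -eD card_gt0; apply/set0Pn; exists y0.
have [x xGF xmin] := @arg_minnP _ x0 (mem (G :\: F)) val x0GF.
have [y yFG ymin] := @arg_minnP _ y0 (mem (F :\: G)) val y0FG.
move: (xGF) (yFG); rewrite !inE => /andP[xF xG] /andP[yG yF].
have xy : x < y.
  rewrite ltnNge; apply/negP=> yx.
  have {}yx : y < x by rewrite ltn_neqAle yx andbT; apply: contraNneq xF => /val_inj <-.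
  have := dom y.+1 (ltn_ord y); rewrite leqNgt => /negP; apply.
  apply: proper_card; apply/properP; split.
    apply/subsetP=> i; rewrite !inE ltnS => /andP[iG iy]; rewrite iy andbT.
    case iF : (i \in F) => //.
    by have := xmin i; rewrite !inE iF iG => /(_ isT); rewrite leqNgt (leq_ltn_trans iy yx).
  by exists y; rewrite !inE ?yF ?(negPf yG) /= ?ltnS ?leqnn.
have sE i : (i \in swap x y F) = (i == x) || (i != y) && (i \in F).
  have [->|ix] := eqVneq i x; first by rewrite in_swapl yF.
  have [->|iy] /= := eqVneq i y; first by rewrite in_swapr (negPf xF).
  by rewrite in_swapD.
apply: (IHm (swap x y F)); first 1 last.
- exact: lA.
- by rewrite card_swap.
- move=> t tn; have [ty|yt] := leqP t y; last first.
    have -> : swap x y F :&: below t = swap x y (F :&: below t).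
      apply/setP=> i; rewrite !inE; case: tpermP => // ->.
        by rewrite yt (ltn_trans xy yt).
      by rewrite yt (ltn_trans xy yt).
    by rewrite card_swap dom.
  apply: subset_leq_card; apply/subsetP=> i; rewrite 2!in_setI sE [i \in below t]inE.
  move=> /andP[+ it]; rewrite it andbT.
  case/orP=> [/eqP-> //|/andP[_ iF]]; apply: contraLR it => iG.
  have := ymin i; rewrite !inE iF iG => /(_ isT) yi.
  by rewrite -leqNgt (leq_trans ty yi).
- rewrite ltnS in ltm; apply: leq_trans ltm; apply: proper_card.
  apply/properP; split; last by exists y;
    rewrite ?inE ?tpermR ?yF ?(negPf yG) ?(negPf xF) ?andbF.
  apply/subsetP=> i; rewrite in_setD sE in_setD => /andP[iG].
  by case/orP=> [/eqP ix|/andP[_ ->]]; [rewrite ix xG in iG | rewrite iG].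
Qed.

(** Delete the largest element [z] of [H] while [H] is too big. Segments not reaching past [z] are
    unaffected, and longer ones still contain all of the remaining set, which has at least [#|F|]
    elements. *)
Lemma exists_dominating_subset (n : nat) (F H : {set 'I_n}) :
    (forall t, t <= n -> #|F :&: below t| <= #|H :&: below t|) ->
  exists G : {set 'I_n}, [/\ G \subset H, #|G| = #|F|
    & forall t, t <= n -> #|F :&: below t| <= #|G :&: below t|].
Proof.
have [m] := ubnP #|H|; elim: m H => // m IHm H ltm dom.
have leFH : #|F| <= #|H| by have := dom n (leqnn n); rewrite !below_all.
have [eFH|neFH] := eqVneq #|F| #|H|; first by exists H.
have ltFH : #|F| < #|H| by rewrite ltn_neqAle neFH.
have [z0 z0H] : exists z, z \in H.
  by apply/set0Pn; rewrite -card_gt0 (leq_ltn_trans _ ltFH).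
have [z zH zmax] := @arg_maxnP _ z0 (mem H) val z0H.
have {}zH : z \in H := zH.
have cH1 : #|H :\ z| = #|H|.-1 by rewrite [#|H|](cardsD1 z) zH.
have [||G [GH cG domG]] := IHm (H :\ z).
- by rewrite cH1; lia.
- move=> t tn; have [tz|zt] := leqP t z.
    suff -> : (H :\ z) :&: below t = H :&: below t by apply: dom.
    apply/setP=> i; rewrite !inE; case: (eqVneq i z) => //= ->.
    by rewrite ltnNge tz andbF.
  suff -> : (H :\ z) :&: below t = H :\ z.
    by rewrite cH1 (leq_trans (subset_leq_card (subsetIl _ _))) //; lia.
  apply/setP=> i; rewrite !inE; case iH : (i \in H); rewrite ?andbF //=.
  by rewrite (leq_ltn_trans (zmax _ iH) zt) andbT.
by exists G; split=> //; apply: subset_trans GH (subsetDl _ _).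
Qed.

(** Read [F] as a walk that goes up at members and down elsewhere, also past the last point: a hit
    at [j] means that the walk is positive after 2j+1 steps. *)
Definition hits (n : nat) (F : {set 'I_n}) (j : nat) : bool := j < #|F :&: below (j.*2.+1)|.

(* If there were no such j, the complement of F would dominate F, and its first
   #|F| elements would form a member of A disjoint from F. *)
Lemma shifted_intersecting_hits (n : nat) (A : {set {set 'I_n}}) (F : {set 'I_n}) :
    left_shifted A -> intersecting_family A -> F \in A -> exists j, hits F j.
Proof.
move=> lA iA FA.
have hitN j : #|F| <= j -> ~~ hits F j.
  by move=> Fj; rewrite /hits -leqNgt (leq_trans (subset_leq_card (subsetIl _ _))).
case: (boolP [exists j : 'I_#|F|, hits F j]) => [/existsP[j hj]|]; first by exists j.
rewrite negb_exists => /forallP noF.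
have {noF hitN} noF j : #|F :&: below (j.*2.+1)| <= j.
  have [jF|/hitN] := ltnP j #|F|; last by rewrite /hits -leqNgt.
  by have := noF (Ordinal jF); rewrite /hits -leqNgt.
have [|G [GF cG dom]] := @exists_dominating_subset n F (~: F).
  move=> t tn.
  have : #|F :&: below t| + #|~: F :&: below t| = t.
    by rewrite [_ :&: below t]setIC [~: F :&: _]setIC -setDE cardsID card_below.
  have {}noF := noF t./2; have := odd_double_half t; case: (odd t) => /= et.
    move: noF; rewrite (_ : t./2.*2.+1 = t); last by lia.
    by move: #|_| #|_| => a b; lia.
  have : #|F :&: below t| <= #|F :&: below (t./2).*2.+1|.
    by apply: subset_leq_card; apply: setIS; apply/subsetP=> i; rewrite !inE; lia.
  by move: noF; move: #|_| #|_| #|_| => a b c; lia.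
have GA := left_shifted_dominated lA FA cG dom.
have /set0Pn[i] := iA _ _ FA GA.
by rewrite inE => /andP[iF /(subsetP GF)]; rewrite inE iF.
Qed.

(** Every hit is below [#|F|], so searching up to [n] finds the first one. A set without hits gets
    the default value [n]. *)
Definition first_hit (n : nat) (F : {set 'I_n}) : nat := find (hits F) (iota 0 n).

Lemma hits_lt_card (n : nat) (F : {set 'I_n}) (j : nat) : hits F j -> j < #|F|.
Proof. by move/leq_trans; apply; apply/subset_leq_card/subsetIl. Qed.

Lemma first_hit_eq (n : nat) (F : {set 'I_n}) (j : nat) :
  hits F j -> (forall i, i < j -> ~~ hits F i) -> first_hit F = j.
Proof.
move=> hj minj; have jn : j < n.
  by apply: leq_trans (hits_lt_card hj) _; rewrite -[leqRHS]card_ord max_card.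
have hasF : has (hits F) (iota 0 n) by apply/hasP; exists j; rewrite // mem_iota.
have := nth_find 0 hasF; have := hasF; rewrite has_find size_iota => ltn.
rewrite nth_iota // => hf; apply/eqP; rewrite eqn_leq; apply/andP; split.
  rewrite leqNgt; apply/negP=> /(before_find 0).
  by rewrite nth_iota // add0n hj.
by rewrite leqNgt; apply: contraL hf => /minj.
Qed.

Lemma first_hitP (n : nat) (F : {set 'I_n}) : (exists j, hits F j) ->
  hits F (first_hit F) /\ (forall i, i < first_hit F -> ~~ hits F i).
Proof.
move=> exj; have [j hj minj] := ex_minnP exj.
have lt_min i : i < j -> ~~ hits F i by apply: contraTN => /minj; rewrite -leqNgt.
by rewrite (@first_hit_eq _ _ j).
Qed.

(** A hit at [i] depends only on the trace on the first 2i+1 points, so the trace up to the first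
    hit determines it. *)
Lemma first_hit_agree (n : nat) (F G : {set 'I_n}) : (exists j, hits F j) ->
    F :&: below (first_hit F).*2.+1 = G :&: below (first_hit F).*2.+1 ->
  first_hit G = first_hit F.
Proof.
move=> /first_hitP[hF minF] eFG.
have eh i : i <= first_hit F -> hits G i = hits F i.
  move=> ij; have sub : below i.*2.+1 \subset @below n (first_hit F).*2.+1.
    by apply/subsetP=> x; rewrite !inE; lia.
  by rewrite /hits -(setIidPr sub) !setIA eFG.
apply: first_hit_eq => [|i ij]; first by rewrite eh.
by rewrite eh 1?ltnW // minF.
Qed.

Lemma card_setI_belowS (n t : nat) (F : {set 'I_n}) :
  #|F :&: below t.+1| <= #|F :&: below t|.+1.
Proof.
have [tn|nt] := ltnP t n; last first.
  apply: leqW; apply: subset_leq_card; apply: setIS; apply/subsetP=> i; rewrite !inE => _.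
  exact: leq_trans (ltn_ord i) nt.
apply: leq_trans (_ : #|Ordinal tn |: (F :&: below t)| <= _).
  apply: subset_leq_card; apply/subsetP=> i; rewrite !inE ltnS leq_eqVlt -val_eqE /=.
  by case/andP=> -> /orP[->|->]; rewrite ?orbT.
by rewrite cardsU1; case: (_ \notin _).
Qed.

(** There was no majority at the previous index, and two further points add at most two elements, so
    the first majority is as narrow as possible. Avoiding [ord0] excludes a hit at 0. *)
Lemma card_first_hit (n : nat) (F : {set 'I_n.+1}) : ord0 \notin F ->
    (exists j, hits F j) ->
  0 < first_hit F /\ #|F :&: below (first_hit F).*2.+1| = (first_hit F).+1.
Proof.
move=> F0 /first_hitP[hF minF]; case: (first_hit F) hF minF => [|j] hF minF.
  move: hF; rewrite /hits card_gt0 => /set0Pn[i]; rewrite !inE => /andP[iF i0].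
  have i00 : i = ord0 by apply: val_inj => /=; lia.
  by rewrite i00 (negPf F0) in iF.
split=> //; apply/eqP; rewrite eqn_leq [_ < _]hF andbT.
have := minF j (ltnSn j); rewrite /hits -leqNgt => jF.
rewrite doubleS; apply: leq_trans (card_setI_belowS _ _) _; rewrite ltnS.
by apply: leq_trans (card_setI_belowS _ _) _.
Qed.

(** As [Q <= P], the ratio of [P - i] to [Q - i] is smallest at [i = 0]. This replaces bounds that
    depend on the first hit by a uniform one. *)
Lemma leq_mul_ratio (P Q i X Y : nat) : i <= Q <= P -> i < P ->
  (P - i) * X <= (Q - i) * Y -> P * X <= Q * Y.
Proof.
case/andP=> iQ QP iP h; rewrite -(@leq_pmul2l (P - i)) ?subn_gt0 //.
have h1 := leq_mul (leqnn P) h.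
have h2 : P * (Q - i) <= (P - i) * Q.
  by rewrite mulnBr mulnBl leq_sub2l // mulnC leq_mul2r QP orbT.
have h3 := leq_mul h2 (leqnn Y).
by rewrite mulnCA (leq_trans h1) // mulnA (mulnA (P - i)).
Qed.

(** * Double counting in a left-compressed intersecting family *)

Section ShiftedCounts.

Variables (n k : nat) (A : {set {set 'I_n.+1}}).
Hypotheses (k_gt0 : 0 < k) (kn : k.*2 < n).
Hypotheses (lA : left_shifted A) (iA : intersecting_family A) (uA : uniform k A).

(** Fix the first hit [j]. Link [F] to the k-sets [D] that avoid [F] and [ord_max] and contain the
    [j] points missing from [F] among the first 2j+1. Disjointness keeps [D] out of [A], and [~: D]
    has the same first hit as [F]. Each [F] has 'C(n-k-j, k-j) partners, each [D] at most
    'C(n-k-j-1, k-j-1). *)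
Lemma card_missing :
  (n - k.+1) * #|[set F in A | (ord0 \notin F) && (ord_max \notin F)]| <=
  k.-1 * #|[set D : {set 'I_n.+1} | [&& #|D| == k, ord0 \in D, ord_max \notin D
    & D \notin A]]|.
Proof.
set X := [set F in A | _]; set Y := [set D : {set 'I_n.+1} | _].
apply: (@leq_card_fibers _ _ _ _ (@first_hit _) (fun D => first_hit (~: D)) _ _ n.+2).
  by move=> F _; rewrite ltnS -[leqRHS](size_iota 0) /first_hit find_size.
move=> j; set Xj := [set F in X | _]; set Yj := [set D in Y | _].
have XjP F : F \in Xj -> [/\ F \in A, ord0 \notin F, ord_max \notin F, first_hit F = j
  & #|F| = k].
  by rewrite !inE => /andP[/and3P[FA -> ->] /eqP ->]; rewrite (uA FA).
have hitA F : F \in A -> exists i, hits F i by exact: shifted_intersecting_hits.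
have [->|[F0 F0X]] := set_0Vmem Xj; first by rewrite cards0 muln0.
have {F0 F0X} [j_gt0 jk] : 0 < j /\ j < k.
  have [FA o0 _ <- <-] := XjP _ F0X; have [-> _] := card_first_hit o0 (hitA _ FA).
  by split=> //; apply: hits_lt_card; have [] := first_hitP (hitA _ FA).
have max_below : ord_max \notin @below n.+1 j.*2.+1 by rewrite inE /=; lia.
(* The count at first hit [j] yields the factors n-k-j and k-j, which are the claimed ones both
   lowered by j-1. *)
apply: (@leq_mul_ratio _ _ j.-1); [by apply/andP; split; lia | by lia |].
have -> : n - k.+1 - j.-1 = n - k - j by lia.
have -> : k.-1 - j.-1 = k - j by lia.
pose e (F D : {set 'I_n.+1}) := (below j.*2.+1 :\: F \subset D) && (D \subset ~: (ord_max
  |: F)).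
have eP F D : F \in Xj -> e F D -> F :&: below j.*2.+1 = ~: D :&: below j.*2.+1.
  move=> FX /andP[/subsetP h1 /subsetP h2]; apply/setP=> i.
  have := h1 i; have := h2 i; rewrite !inE; case: (i < _); rewrite ?andbF ?andbT //.
  case: (i \in F); case: (i \in D) => //=.
    by rewrite orbT => /(_ isT).
  by move=> _ /(_ isT).
have dc : #|Xj| * 'C(n - k - j, k - j) <= #|Yj| * 'C((n - k - j).-1, (k - j).-1).
  apply: (double_count (e := e)).
    move=> F FX; have [FA F0 Fm fF cF] := XjP _ FX.
    have [_ cFj] := card_first_hit F0 (hitA _ FA); rewrite fF in cFj.
    have cC : #|below j.*2.+1 :\: F| = j.
      by rewrite cardsD setIC cFj card_below; lia.
    have cE : #|~: (ord_max |: F)| = n - k.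
      by rewrite cardsCs setCK card_ord cardsU1 Fm cF; lia.
    rewrite -[X in 'C(_, k - X)]cC -[X in 'C(_ - X, _)]cC -cE -card_set_interval;
      last by rewrite cC; lia.
      apply: subset_leq_card; apply/subsetP=> D; rewrite !inE => /and3P[h1 h2 h3].
      have eFD : e F D by rewrite /e h1.
      rewrite h3 /= [e F D]eFD andbT; apply/andP; split; last first.
        by rewrite (@first_hit_agree _ F) ?fF //; [exact: hitA | exact: eP].
      have hD0 : ord0 \in D by apply: (subsetP h1); rewrite !inE F0.
      have hDm : ord_max \notin D by apply/negP=> /(subsetP h2); rewrite !inE eqxx.
      rewrite hD0 hDm /=; apply/negP=> DA; have /set0Pn[i] := iA FA DA.
      rewrite inE => /andP[iF /(subsetP h2)]; by rewrite !inE iF orbT.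
    apply/subsetP=> i; rewrite !inE => /andP[/negPf-> ij]; rewrite orbF.
    by apply: contraNneq max_below => <-; rewrite inE.
  move=> D; rewrite !inE => /andP[/and4P[/eqP cD D0 Dm DA] fD].
  set Z := [set F in Xj | e F D].
  (* One partner [F] of [D] suffices to fix the trace of [D]: exactly j+1 of the first 2j+1 points
     lie outside it. *)
  have [->|[F]] := set_0Vmem Z; first by rewrite cards0.
  rewrite inE => /andP[FX eFD]; have [FA F0 Fm fF cF] := XjP _ FX.
  have [_ cFj] := card_first_hit F0 (hitA _ FA); rewrite fF in cFj.
  have cC : #|below j.*2.+1 :\: D| = j.+1 by rewrite setDE setIC -(eP F).
  have cE : #|~: (ord_max |: D)| = n - k.
    by rewrite cardsCs setCK card_ord cardsU1 Dm cD; clear; lia.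
  have -> : (n - k - j).-1 = #|~: (ord_max |: D)| - #|below j.*2.+1 :\: D|.
    by rewrite cE cC; clear; lia.
  have -> : (k - j).-1 = k - #|below j.*2.+1 :\: D| by rewrite cC; clear; lia.
  rewrite -card_set_interval; last by rewrite cC.
    apply: subset_leq_card; apply/subsetP=> G; rewrite inE => /andP[GX eGD].
    have [_ _ Gm _ cG] := XjP _ GX; rewrite inE cG eqxx andbT.
    have /andP[/subsetP h1 /subsetP h2] := eGD.
    apply/andP; split; apply/subsetP=> i; rewrite !inE.
      by case/andP=> iD ij; apply: contraNT iD => iG; apply: h1; rewrite !inE iG.
    move=> iG; rewrite negb_or; apply/andP; split; first by apply: contraNneq Gm => <-.
    by apply/negP=> /h2; rewrite !inE iG orbT.
  apply/subsetP=> i; rewrite !inE => /andP[/negPf-> ij]; rewrite orbF.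
  by apply: contraNneq max_below => <-; rewrite inE.
have kj : 0 < k - j by rewrite subn_gt0.
have cpos : 0 < 'C(n - k - j, k - j) by rewrite bin_gt0; lia.
(* Absorption expresses the smaller binomial through the larger one, which then cancels and leaves
   the ratio of n-k-j to k-j. *)
have diag := mul_bin_diag (n - k - j) (k - j).-1; rewrite (prednK kj) in diag.
rewrite -(leq_pmul2r cpos) -mulnA; move: (leq_mul (leqnn (n - k - j)) dc) => /leq_trans;
  apply.
by rewrite mulnCA diag mulnCA mulnA.
Qed.

(** Link [F] to the sets [G] obtained by replacing [ord_max] with a point [z] outside [F] and beyond
    the first 2j+1 points, [j] being the first hit. There are n-k-j+1 choices of [z], and
    compression puts [G] in [A] with the same first hit. Conversely [F] arises from [G] by dropping
    one of its k-j-1 points beyond that segment. *)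
Lemma card_last_only :
  (n - k) * #|[set F in A | (ord0 \notin F) && (ord_max \in F)]| <=
  k.-2 * #|[set F in A | (ord0 \notin F) && (ord_max \notin F)]|.
Proof.
set X := [set F in A | _]; set Y := [set F in A | _].
apply: (@leq_card_fibers _ _ _ _ (@first_hit _) (@first_hit _) _ _ n.+2).
  by move=> F _; rewrite ltnS -[leqRHS](size_iota 0) /first_hit find_size.
move=> j; set Xj := [set F in X | _]; set Yj := [set F in Y | _].
have XjP F : F \in Xj -> [/\ F \in A, ord0 \notin F, ord_max \in F, first_hit F = j
  & #|F| = k].
  by rewrite !inE => /andP[/and3P[FA -> ->] /eqP ->]; rewrite (uA FA).
have hitA F : F \in A -> exists i, hits F i by exact: shifted_intersecting_hits.
have below_max t : t <= n -> ord_max \notin @below n.+1 t by move=> tn; rewrite inE -leqNgt.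
have [->|[F0 F0X]] := set_0Vmem Xj; first by rewrite cards0 muln0.
(* The first 2j+1 points contain j+1 members of the set, and [ord_max] is a further member beyond
   them. *)
have {F0X} [j_gt0 jk] : 0 < j /\ j.+1 < k.
  have [FA o0 Fm <- cF] := XjP _ F0X; have [-> cFj] := card_first_hit o0 (hitA _ FA).
  split=> //; rewrite -cFj -cF; apply: proper_card; apply/properP; split;
    first exact: subsetIl.
  exists ord_max => //; rewrite inE negb_and; apply/orP; right; apply: below_max.
  have := hits_lt_card (first_hitP (hitA _ FA)).1; rewrite cF; lia.
have max_below : ord_max \notin @below n.+1 j.*2.+1 by apply: below_max; lia.
apply: (@leq_mul_ratio _ _ j.-1); [by apply/andP; split; lia | by lia |].
have -> : n - k - j.-1 = n - k - j + 1 by lia.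
have -> : k.-2 - j.-1 = k - j.+1 by lia.
pose e (F G : {set 'I_n.+1}) :=
  (F :\ ord_max \subset G) && (G \subset ~: (ord_max |: (below j.*2.+1 :\: F))).
have eP F G : F \in Xj -> e F G -> F :&: below j.*2.+1 = G :&: below j.*2.+1.
  move=> FX /andP[/subsetP h1 /subsetP h2]; apply/setP=> i.
  have := h1 i; have := h2 i; rewrite !inE.
  have [->|_] /= := eqVneq i ord_max; first by rewrite inE in max_below;
    rewrite (negPf max_below) !andbF.
  case: (i < _); rewrite ?andbF ?andbT //.
  case: (i \in F); case: (i \in G) => //=; first by move=> _ /(_ isT).
  by move/(_ isT).
rewrite mulnC [leqRHS]mulnC; apply: (double_count (e := e)).
  move=> F FX; have [FA F0' Fm fF cF] := XjP _ FX.
  have [_ cFj] := card_first_hit F0' (hitA _ FA); rewrite fF in cFj.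
  have cC : #|F :\ ord_max| = k.-1 by rewrite -cF [in RHS](cardsD1 ord_max) Fm.
  have cE : #|~: (ord_max |: (below j.*2.+1 :\: F))| = n - j.
    rewrite cardsCs setCK card_ord cardsU1 inE (negPf max_below) andbF.
    by rewrite cardsD setIC cFj card_below; lia.
  have -> : n - k - j + 1 = 'C(n - j - k.-1, k - k.-1).
    by rewrite (_ : k - k.-1 = 1) ?bin1; lia.
  rewrite -[X in 'C(_, k - X)]cC -[X in 'C(_ - X, _)]cC -cE -card_set_interval;
    last by rewrite cC; lia.
    apply: subset_leq_card; apply/subsetP=> G; rewrite !inE => /and3P[h1 h2 /eqP cG].
    have eFG : e F G by rewrite /e h1.
    have G0 : ord0 \notin G.
      by apply/negP=> /(subsetP h2); rewrite !inE F0' andbT negb_or /= andbF.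
    have Gm : ord_max \notin G by apply/negP=> /(subsetP h2); rewrite !inE eqxx.
    rewrite G0 Gm eFG !andbT /= (@first_hit_agree _ F) ?fF ?eqxx ?andbT; first last.
    - exact: eP.
    - exact: hitA.
    have [z zG] : exists z, z \in G :\: (F :\ ord_max).
      by apply/set0Pn; rewrite -card_gt0 cardsD (setIidPr h1) cC cG; clear -k_gt0; lia.
    have eG : G = z |: (F :\ ord_max).
      apply/esym/eqP; rewrite eqEcard subUset h1 andbT sub1set.
      move: zG; rewrite inE => /andP[zF ->] /=.
      by rewrite cG cardsU1 zF cC; clear -k_gt0; lia.
    move: zG; rewrite !inE => /andP[zF zG].
    have zm : z != ord_max by apply: contraNneq Gm => <-.
    rewrite zm /= in zF.
    (* [G] is [F] with [ord_max] moved down to [z], so compression applies. *)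
    suff -> : G = swap z ord_max F.
      apply: lA => //; rewrite ltn_neqAle; apply/andP; split;
        first by rewrite -(inj_eq val_inj) in zm.
      by rewrite /= -ltnS ltn_ord.
    rewrite eG; apply/setP=> i.
    have [->|iz] := eqVneq i z; first by rewrite in_swapl Fm !inE eqxx.
    have [->|im] := eqVneq i ord_max.
      by rewrite in_swapr (negPf zF) !inE eqxx eq_sym (negPf zm).
    by rewrite in_swapD // !inE (negPf iz) im.
  by apply/subsetP=> i; rewrite !inE => /andP[/negPf-> ->] //.
move=> G; rewrite !inE => /andP[/and3P[GA G0 Gm] _].
set Z := [set F in Xj | e F G].
have [->|[F]] := set_0Vmem Z; first by rewrite cards0.
rewrite inE => /andP[FX eFG]; have [FA F0' Fm fF cF] := XjP _ FX.
have [_ cFj] := card_first_hit F0' (hitA _ FA); rewrite fF in cFj.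
have cC : #|ord_max |: (G :&: below j.*2.+1)| = j.+2.
  by rewrite cardsU1 inE (negPf Gm) -(eP F) // cFj.
have cE : #|ord_max |: G| = k.+1 by rewrite cardsU1 Gm (uA GA).
apply: (@leq_trans 'C(k.+1 - j.+2, k - j.+2)); last first.
  have [->|jk2] := eqVneq k j.+2; first by rewrite subnn bin0 subSnn.
  rewrite -bin_sub; last by clear; lia.
  by rewrite (_ : k.+1 - j.+2 - (k - j.+2) = 1) ?bin1; clear -jk; lia.
rewrite -cC -cE -card_set_interval; first last.
- by rewrite cC.
- exact/setUS/subsetIl.
apply: subset_leq_card; apply/subsetP=> H; rewrite inE => /andP[HX eHG].
have [_ _ Hm _ cH] := XjP _ HX; rewrite inE cH eqxx andbT.
rewrite -(eP H) // subUset sub1set Hm subsetIl /=.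
by rewrite -subDset; have /andP[] := eHG.
Qed.

End ShiftedCounts.

(** * Oppositely compressed pairs *)

Definition hitting (T : finType) (k : nat) (x y : T) : {set {set T}} :=
  [set F : {set T} | (#|F| == k) && ((x \in F) || (y \in F))].

Definition in_star (T : finType) (A : {set {set T}}) (x : T) : Prop :=
  forall F, F \in A -> x \in F.

Lemma card_star (T : finType) (k : nat) (x : T) : 0 < k ->
  #|[set F : {set T} | (#|F| == k) && (x \in F)]| = 'C(#|T|.-1, k.-1).
Proof.
move=> k0; have := @card_set_interval T [set x] setT k (subsetT _).
rewrite cards1 cardsT !subn1 => <- //; apply: eq_card => F; rewrite !inE.
by rewrite sub1set subsetT andbC.
Qed.

Lemma card_hitting (T : finType) (k : nat) (x y : T) : 0 < k -> x != y ->
  #|hitting k x y| = 'C(#|T|.-1, k.-1) + 'C(#|T|.-2, k.-1).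
Proof.
move=> k0 xy; rewrite -(cardsID [set F : {set T} | x \in F]); congr (_ + _).
  rewrite -(@card_star _ _ x) //; apply: eq_card => F; rewrite !inE.
  by case: (x \in F); rewrite ?andbF ?andbT.
have sub : [set y] \subset [set~ x] by rewrite sub1set !inE eq_sym.
have := @card_set_interval T [set y] [set~ x] k sub.
rewrite cards1 cardsC1 !subn1 => <- //; apply: eq_card => F; rewrite !inE sub1set.
rewrite subsetC sub1set inE.
by case: (x \in F); case: (y \in F); case: (_ == k).
Qed.

(** Reversing the order carries right-compressed families to left-compressed ones, so the two counts
    above serve both families. *)
Definition rev_set (n : nat) (F : {set 'I_n}) : {set 'I_n} := [set i | rev_ord i \in F].

Lemma rev_setK (n : nat) : involutive (@rev_set n).
Proof. by move=> F; apply/setP=> i; rewrite !inE rev_ordK. Qed.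

Lemma card_rev_set (n : nat) (F : {set 'I_n}) : #|rev_set F| = #|F|.
Proof.
rewrite -(card_imset F (@rev_ord_inj n)); apply: eq_card => i.
by rewrite inE -{2}(rev_ordK i) mem_imset //; apply: rev_ord_inj.
Qed.

Definition rev_family (n : nat) (A : {set {set 'I_n}}) : {set {set 'I_n}} :=
  [set F | rev_set F \in A].

Lemma card_rev_family (n : nat) (A B : {set {set 'I_n}}) :
  (forall F, (rev_set F \in A) = (F \in B)) -> #|A| = #|B|.
Proof.
move=> h; rewrite -(card_imset B (inv_inj (@rev_setK n))); apply: eq_card => F.
by rewrite -{2}(rev_setK F) mem_imset ?h ?rev_setK //;
  [rewrite -h rev_setK | apply: inv_inj (@rev_setK n)].
Qed.

Definition right_shifted (n : nat) (A : {set {set 'I_n}}) : Prop :=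
  forall (x y : 'I_n) F, y < x -> F \in A -> x \notin F -> y \in F -> swap x y F \in A.

Lemma rev_left_shifted (n : nat) (A : {set {set 'I_n}}) :
  right_shifted A -> left_shifted (rev_family A).
Proof.
move=> rA x y F xy; rewrite !inE => FA xF yF.
have -> : rev_set (swap x y F) = swap (rev_ord x) (rev_ord y) (rev_set F).
  apply/setP=> i; rewrite !inE; case: tpermP => [e|e|nx ny].
  - by rewrite (_ : i = rev_ord x) ?tpermL ?rev_ordK // -e rev_ordK.
  - by rewrite (_ : i = rev_ord y) ?tpermR ?rev_ordK // -e rev_ordK.
  rewrite tpermD ?rev_ordK //; apply/eqP => e; first by apply: nx; rewrite -e rev_ordK.
  by apply: ny; rewrite -e rev_ordK.
apply: rA; rewrite ?inE ?rev_ordK //=; have := ltn_ord y; lia.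
Qed.

Lemma rev_intersecting (n : nat) (A : {set {set 'I_n}}) :
  intersecting_family A -> intersecting_family (rev_family A).
Proof.
move=> iA F G; rewrite !inE => FA GA; have /set0Pn[i] := iA _ _ FA GA.
by rewrite !inE => h; apply/set0Pn; exists (rev_ord i); rewrite inE.
Qed.

Lemma rev_uniform (n k : nat) (A : {set {set 'I_n}}) :
  uniform k A -> uniform k (rev_family A).
Proof. by move=> uA F; rewrite inE => /uA; rewrite card_rev_set. Qed.

(** Chaining the two bounds gives [P0 * P1 * (y + a) <= Q0 * (Q1 + P1) * m], which is below
    [P0 * P1 * m] once [m] is positive. If [m = 0], then [a] and [y] vanish in turn. *)
Lemma deficit_arith (P0 P1 Q0 Q1 a m y : nat) : 0 < P0 -> 0 < P1 ->
    Q0 * (Q1 + P1) < P0 * P1 -> P0 * a <= Q0 * m -> P1 * y <= Q1 * a ->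
  m = 0 /\ a = 0 /\ y = 0 \/ y + a < m.
Proof.
move=> p0 p1 hQ ha hy; case: (posnP m) => [m0|mpos]; [left | right].
  have a0 : a = 0 by move: ha; rewrite m0 muln0 leqn0 muln_eq0; lia.
  by split=> //; split=> //; move: hy; rewrite a0 muln0 leqn0 muln_eq0; lia.
rewrite -(@ltn_pmul2l (P0 * P1)) ?muln_gt0 ?p0 //.
have h1 : P1 * (y + a) <= (Q1 + P1) * a by rewrite mulnDr mulnDl leq_add2r.
have h2 : P0 * P1 * (y + a) <= Q0 * (Q1 + P1) * m.
  rewrite -mulnA; apply: leq_trans (leq_mul (leqnn P0) h1) _.
  by rewrite mulnCA -mulnA [leqRHS]mulnCA leq_mul2l ha orbT.
by apply: leq_ltn_trans h2 _; rewrite ltn_pmul2r.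
Qed.

(** Compare the union with all k-sets hitting an end point. The gains [A0], [B0'] outside and the
    corrections [Ay], [Bx'] inside are weighed against the absent sets [MA], [MB'], separately for
    [A] and [B]. By [deficit_arith] neither family has a net gain, and equality makes all gains and
    corrections vanish, which leaves stars. *)
Lemma shifted_pair_bound (n k : nat) (A B : {set {set 'I_n.+1}}) :
    1 < k -> k.*2 < n -> k.-1 * (n - 2) < (n - k.+1) * (n - k) ->
    left_shifted A -> right_shifted B ->
    intersecting_family A -> intersecting_family B -> uniform k A -> uniform k B ->
  #|A :|: B| <= #|hitting k (@ord0 n) ord_max| /\
  (#|A :|: B| = #|hitting k (@ord0 n) ord_max| -> in_star A ord0 /\ in_star B ord_max).
Proof.
move=> k1 kn num lA rB iA iB uA uB.
have k0 : 0 < k by apply: ltnW.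
have lB := rev_left_shifted rB.
have iB' := rev_intersecting iB; have uB' := rev_uniform uB.
have mA := card_missing k0 kn lA iA uA; have yA := card_last_only k0 kn lA iA uA.
have mB := card_missing k0 kn lB iB' uB'; have yB := card_last_only k0 kn lB iB' uB'.
have rev0 : rev_ord ord0 = @ord_max n by apply: val_inj; rewrite /= subn1.
have revm : rev_ord ord_max = @ord0 n by apply: val_inj; rewrite /= subnn.
have aD : k.-1 * (k.-2 + (n - k)) < (n - k.+1) * (n - k) by rewrite (_ : k.-2 + _ = n - 2);
  lia.
have cA := deficit_arith _ _ aD mA yA; have cB := deficit_arith _ _ aD mB yB.
have {cA} cA := cA ltac:(lia) ltac:(lia); have {cB} cB := cB ltac:(lia) ltac:(lia).
move: cA cB {mA yA mB yB}.
set MA := [set D : {set 'I_n.+1} | [&& #|D| == k, ord0 \in D, ord_max \notin D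
  & D \notin A]].
set A0 := [set F in A | (ord0 \notin F) && (ord_max \notin F)].
set Ay := [set F in A | (ord0 \notin F) && (ord_max \in F)].
set MB := [set D : {set 'I_n.+1} | [&& #|D| == k, ord0 \in D, ord_max \notin D
  & D \notin rev_family B]].
set B0 := [set F in rev_family B | (ord0 \notin F) && (ord_max \notin F)].
set Bx := [set F in rev_family B | (ord0 \notin F) && (ord_max \in F)] => cA cB.
pose MB' := [set D : {set 'I_n.+1} | [&& #|D| == k, ord0 \notin D, ord_max \in D
  & D \notin B]].
pose B0' := [set F in B | (ord0 \notin F) && (ord_max \notin F)].
pose Bx' := [set F in B | (ord0 \in F) && (ord_max \notin F)].
have eMB : #|MB| = #|MB'|.
  apply: card_rev_family => F; rewrite !inE rev_setK card_rev_set rev0 revm.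
  by case: (_ == k); case: (ord_max \in F); case: (ord0 \in F).
have eB0 : #|B0| = #|B0'|.
  by apply: card_rev_family => F; rewrite !inE rev_setK rev0 revm [X in _ && X]andbC.
have eBx : #|Bx| = #|Bx'|.
  by apply: card_rev_family => F; rewrite !inE rev_setK rev0 revm [X in _ && X]andbC.
rewrite {}eMB {}eB0 {}eBx in cB.
set H := hitting _ _ _; set U := A :|: B.
have hU : #|U :\: H| <= #|A0| + #|B0'|.
  apply: leq_trans (leq_card_setU _ _); apply: subset_leq_card.
  apply/subsetP=> F; rewrite !inE => /andP[nH].
  have [FA _|_ /= FB] := boolP (F \in A).
    by move: nH; rewrite (uA _ FA) eqxx /= negb_or => ->.
  by move: nH; rewrite (uB _ FB) eqxx FB /= negb_or => ->.
(* A set of [MA] or [MB'] lies in [H]; if it is nevertheless in [U], the other family supplies it,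
   and it is counted in [Bx'] or [Ay]. *)
have hH : #|U :&: H| + (#|MA| + #|MB'|) <= #|H| + (#|Bx'| + #|Ay|).
  rewrite -[#|H|](cardsID U) setIC -addnA leq_add2l.
  apply: (@leq_trans (#|MA :|: MB'|)).
    rewrite cardsU (_ : MA :&: MB' = set0) ?cards0 ?subn0 //.
    by apply/setP=> F; rewrite !inE; case: (ord0 \in F); rewrite ?andbF.
  apply: leq_trans (leq_add (leqnn _) (leq_card_setU _ _)).
  apply: leq_trans (leq_card_setU _ _); apply: subset_leq_card.
  apply/subsetP=> F; rewrite !inE => /orP[] /and4P[-> h1 h2 /negPf h3];
    rewrite h1 h3 /= ?(negPf h1) ?(negPf h2) ?h2 /= ?orbT ?andbT ?orbF.
    by case: (F \in B).
  by case: (F \in A).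
have cU : #|U| = #|U :&: H| + #|U :\: H| by rewrite cardsID.
split; first by lia.
move=> eU; have [zA zB] : #|A0| + #|Ay| = 0 /\ #|B0'| + #|Bx'| = 0 by lia.
split=> F FX; apply/negPn/negP=> nF.
  have [/eqP] : #|A0| = 0 /\ #|Ay| = 0 by lia.
  rewrite cards_eq0 => /eqP/setP/(_ F) h /eqP; rewrite cards_eq0 => /eqP/setP/(_ F).
  by move: h; rewrite !inE FX nF /=; case: (_ \in _).
have [/eqP] : #|B0'| = 0 /\ #|Bx'| = 0 by lia.
rewrite cards_eq0 => /eqP/setP/(_ F) h /eqP; rewrite cards_eq0 => /eqP/setP/(_ F).
by move: h; rewrite !inE FX nF /= !andbT; case: (_ \in _).
Qed.

(** * Unions of two intersecting families of sets *)

Lemma exists_subset_card (T : finType) (S : {set T}) (m : nat) :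
  m <= #|S| -> exists2 K : {set T}, K \subset S & #|K| = m.
Proof.
rewrite -bin_gt0 -cards_draws card_gt0 => /set0Pn[K].
by rewrite inE => /andP[sKS /eqP cK]; exists K.
Qed.

Lemma exists_avoiding (T : finType) (m r : nat) (S : {set T}) (s : seq T) :
    #|S| <= r -> m + r + size s <= #|T| ->
  exists K : {set T}, [/\ #|K| = m, [disjoint K & S] & {in s, forall z, z \notin K}].
Proof.
move=> Sr mT; pose E := S :|: [set z in s].
have cE : #|E| <= r + size s.
  apply: leq_trans (leq_card_setU _ _) _; apply: leq_add => //.
  by rewrite cardsE card_size.
have [|K sK cK] := @exists_subset_card T (~: E) m; first by have := cardsC E; lia.
exists K; split=> // [|z zs].
  by rewrite disjoint_subset; apply: subset_trans sK _; apply/subsetP=> i;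
    rewrite !inE negb_or => /andP[].
by apply/negP=> /(subsetP sK); rewrite !inE zs orbT.
Qed.

(* The connectedness of a Kneser graph on T minus three points: K can be joined
   to the exchanged set b |: (K :\ a) through any L disjoint from b |: K. *)
Lemma kneser_constant (T : finType) (m : nat) (x y v : T) (c : {set T} -> bool) :
    m.*2 + 4 <= #|T| ->
    let good := fun K : {set T} => [&& #|K| == m, x \notin K, y \notin K & v \notin K] in
    (forall K L, good K -> good L -> [disjoint K & L] -> c K -> c L) ->
  forall K L, good K -> good L -> c K -> c L.
Proof.
move=> mT good cP K L; have [r] := ubnP #|K :\: L|; elim: r K => // r IHr K ltr gK gL cK.
have [/eqP|[a aKL]] := set_0Vmem (K :\: L).
  rewrite finset.setD_eq0 => sKL; suff <- : K = L by [].
  apply/eqP; rewrite eqEcard sKL /=.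
  by have /and4P[/eqP-> _ _ _] := gK; have /and4P[/eqP-> _ _ _] := gL.
have /and4P[/eqP cardK xK yK vK] := gK; have /and4P[/eqP cardL xL yL vL] := gL.
have [b bLK] : exists b, b \in L :\: K.
  apply/set0Pn; rewrite -card_gt0 cardsD setIC cardL -cardK -cardsD card_gt0.
  by apply/set0Pn; exists a.
move: (aKL) (bLK); rewrite !inE => /andP[aL aK] /andP[bK bL].
have ba : b != a by apply: contraNneq bK => ->.
have bN z : z \notin L -> z != b by apply: contraNneq => ->.
have gK' : good (b |: (K :\ a)).
  apply/and4P; split; last 3 first.
  - by rewrite !inE (negPf (bN _ xL)) (negPf xK) andbF.
  - by rewrite !inE (negPf (bN _ yL)) (negPf yK) andbF.
  - by rewrite !inE (negPf (bN _ vL)) (negPf vK) andbF.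
  by rewrite cardsU1 !inE ba bK /= -cardK [X in _ == X](cardsD1 a) aK.
have [||M [cM dM sM]] := @exists_avoiding T m m K [:: x; y; v; b].
- by rewrite cardK.
- by rewrite addnn.
have gM : good M by rewrite /good cM eqxx !sM // !inE eqxx ?orbT.
have cMt : c M by apply: cP gK gM _ cK; rewrite disjoint_sym.
apply: (IHr (b |: (K :\ a))) => //; last first.
  apply: cP gM gK' _ cMt; rewrite disjoint_sym disjoints_subset; apply/subsetP=> i.
  rewrite !inE => /orP[/eqP->|/andP[_ iK]]; first by rewrite sM // !inE eqxx !orbT.
  by rewrite (disjointFl dM).
rewrite ltnS in ltr; apply: leq_trans ltr; apply: proper_card.
apply/properP; split; last by exists a; rewrite // !inE eq_sym (negPf ba) eqxx /= andbF.
by apply/subsetP=> i; rewrite !inE => /andP[iL /orP[/eqP e|/andP[_ ->]]];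
  [rewrite e bL in iL | rewrite iL].
Qed.

(** If [u != x], then [A] is already a star at [u]. If [u = x], each (k-1)-set [K] avoiding [x],
    [y], [v] has [x |: K] or [y |: K] in [A]. Disjoint [K] and [L] cannot choose differently, as
    [x |: K] and [y |: L] would be disjoint, so Kneser connectedness makes one choice [z] work for
    all [K]. A member avoiding [z] would then miss some [z |: K]. *)
Lemma unshift_star (T : finType) (k : nat) (x y u v : T) (A : {set {set T}}) :
    0 < k -> k.*2 + 2 <= #|T| -> x != y -> u != v ->
    intersecting_family A -> uniform k A -> in_star (shift x y A) u ->
    (forall F : {set T}, #|F| = k -> u \in F -> v \notin F -> F \in shift x y A) ->
  exists z, in_star A z.
Proof.
move=> k0 kT xy uv iA uA sA fullA.
have [ux|ux] := eqVneq u x; last first.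
  exists u => F FA; have [FA'|FA'] := boolP (F \in shift x y A); first exact: sA.
  have : swap x y F \in shift x y A.
    move: FA'; rewrite !inE swapK tpermL tpermR FA.
    by case: (x \in F); case: (y \in F) => //=; rewrite ?orbT ?andbT //.
  move/sA; have [uy|uy] := eqVneq u y; last by rewrite in_swapD.
  move: FA'; rewrite uy in_swapr inE FA /=.
  by case: (x \in F); case: (y \in F).
subst u.
pose good (K : {set T}) := [&& #|K| == k.-1, x \notin K, y \notin K & v \notin K].
have goodA K : good K -> x |: K \in A \/ y |: K \in A.
  case/and4P=> /eqP cK xK yK vK.
  have := fullA (x |: K); rewrite cardsU1 xK cK add1n prednK // !inE eqxx.
  rewrite [v == x]eq_sym (negPf uv) (negPf vK) => /(_ erefl isT isT).
  rewrite (eq_sym y) (negPf xy) (negPf yK) /=.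
  case/orP=> [|hs]; [by left | right; rewrite (_ : y |: K = swap x y (x |: K)) //].
  apply/setP=> i; have [->|ix] := eqVneq i x.
    by rewrite in_swapl !inE (negPf xy) (eq_sym y) (negPf xy) (negPf xK) (negPf yK).
  have [->|iy] := eqVneq i y; first by rewrite in_swapr !inE !eqxx.
  by rewrite in_swapD // !inE (negPf ix) (negPf iy).
have starP z : z \in [:: x; y] -> (forall K, good K -> z |: K \in A) -> in_star A z.
  move=> zxy fullz F FA; apply/negPn/negP=> zF.
  have [||K [cK dK sK]] := @exists_avoiding T k.-1 k F [:: x; y; v].
  - by rewrite (uA _ FA).
  - by apply: leq_trans kT; rewrite /=; clear -k0; lia.
  have gK : good K by rewrite /good cK eqxx !sK // !inE eqxx ?orbT.
  have /set0Pn[i] := iA _ _ FA (fullz _ gK).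
  rewrite !inE => /andP[iF /orP[/eqP e|iK]]; first by rewrite -e iF in zF.
  by rewrite (disjointFr dK iK) in iF.
have [||K0 [cK0 _ sK0]] := @exists_avoiding T k.-1 0 set0 [:: x; y; v].
- by rewrite cards0.
- by apply: leq_trans kT; rewrite /=; clear -k0; lia.
have gK0 : good K0 by rewrite /good cK0 eqxx !sK0 // !inE eqxx ?orbT.
have cross K L : good K -> good L -> [disjoint K & L] -> x |: K \in A -> y |: L \in A ->
  False.
  move=> /and4P[_ xK yK vK] /and4P[_ xL yL vL] dKL KA LA; have /set0Pn[i] := iA _ _ KA LA.
  rewrite !inE => /andP[/orP[/eqP->|iK]].
    by rewrite (negPf xy) (negPf xL).
  by rewrite (disjointFr dKL iK) orbF => /eqP e; rewrite -e iK in yK.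
have kT' : k.-1.*2 + 4 <= #|T| by apply: leq_trans kT; clear -k0; lia.
have [xA|yA] := goodA _ gK0.
  exists x; apply: starP => [|K gK]; first by rewrite !inE eqxx.
  apply: (@kneser_constant T k.-1 x y v (fun K => x |: K \in A) kT' _ K0 K gK0 gK xA).
  move=> {}K L {}gK gL dKL KA; have [//|LA] := goodA _ gL.
  by case: (cross K L).
exists y; apply: starP => [|K gK]; first by rewrite !inE eqxx orbT.
apply: (@kneser_constant T k.-1 x y v (fun K => y |: K \in A) kT' _ K0 K gK0 gK yA).
move=> {}K L {}gK gL dKL KA; have [LA|//] := goodA _ gL.
by case: (cross L K); rewrite // disjoint_sym.
Qed.

Lemma left_shiftedP (n : nat) (A : {set {set 'I_n}}) :
  (forall x y : 'I_n, x < y -> shift x y A = A) -> left_shifted A.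
Proof.
move=> sA x y F xy FA xF yF; move: (FA); rewrite -{1}(sA x y xy) inE.
by rewrite (negPf xF) yF /= => /andP[].
Qed.

Lemma right_shiftedP (n : nat) (A : {set {set 'I_n}}) :
  (forall x y : 'I_n, y < x -> shift x y A = A) -> right_shifted A.
Proof.
move=> sA x y F xy FA xF yF; move: (FA); rewrite -{1}(sA x y xy) inE.
by rewrite (negPf xF) yF /= => /andP[].
Qed.

(** Compress until stable. At equality the compressed union is all of [hitting k u v], so
    [unshift_star] recovers centres for [A] and [B]. They differ, because a single star is too
    small. *)
Lemma union_intersecting_bound (n k : nat) (A B : {set {set 'I_n.+1}}) :
    1 < k -> k.*2 < n -> k.-1 * (n - 2) < (n - k.+1) * (n - k) ->
    intersecting_family A -> intersecting_family B -> uniform k A -> uniform k B ->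
  #|A :|: B| <= 'C(n, k.-1) + 'C(n.-1, k.-1) /\
  (#|A :|: B| = 'C(n, k.-1) + 'C(n.-1, k.-1) ->
   exists u v, [/\ u != v, in_star A u & in_star B v]).
Proof.
move=> k1 kn num; have k0 : 0 < k by apply: ltnW.
have cH (u v : 'I_n.+1) : u != v -> #|hitting k u v| = 'C(n, k.-1) + 'C(n.-1, k.-1).
  by move=> uv; rewrite card_hitting // card_ord.
have om : @ord0 n != ord_max by rewrite -val_eqE /=; lia.
(* Positions are weighted from the left for [A] and from the right for [B], so each effective pair
   of opposite moves lowers the sum. *)
pose W (w : 'I_n.+1 -> nat) (X : {set {set 'I_n.+1}}) := \sum_(F in X) \sum_(i in F) w i.
have [r] := ubnP (W val A + W (fun i => rev_ord i) B).
elim: r A B => // r IHr A B ltr iA iB uA uB.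
pose moves := [exists p : 'I_n.+1 * 'I_n.+1,
  (p.1 < p.2) && ((shift p.1 p.2 A != A) || (shift p.2 p.1 B != B))].
have [/existsP[[x y] /= /andP[xy nAB]]|stable] := boolP moves; last first.
  have stab (x y : 'I_n.+1) : x < y -> shift x y A = A /\ shift y x B = B.
    move=> xy; have := stable; rewrite negb_exists => /forallP/(_ (x, y)).
    rewrite /= xy /= negb_or !negbK.
    by case/andP=> /eqP-> /eqP->.
  have lA : left_shifted A by apply: left_shiftedP => x y /stab[].
  have rB : right_shifted B by apply: right_shiftedP => x y /stab[].
  have := shifted_pair_bound k1 kn num lA rB iA iB uA uB.
  by rewrite cH // => -[leU eqU]; split=> // /eqU[sA sB]; exists ord0, ord_max.
have nxy : x != y by rewrite -val_eqE neq_ltn xy.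
have [] := IHr (shift x y A) (shift y x B) _ (shift_intersecting iA) (shift_intersecting iB)
  (shift_uniform uA) (shift_uniform uB).
  rewrite ltnS in ltr; apply: leq_trans ltr.
  have wA : shift x y A != A -> W val (shift x y A) < W val A by apply: shift_weight.
  have wB : shift y x B != B -> W (fun i => rev_ord i)
    (shift y x B) < W (fun i => rev_ord i) B.
    by apply: shift_weight => /=; have := ltn_ord y; lia.
  have [eA|/wA{}wA] := eqVneq (shift x y A) A; have [eB|/wB{}wB] := eqVneq (shift y x B) B.
  - by rewrite eA eB !eqxx in nAB.
  - by rewrite eA ltn_add2l.
  - by rewrite eB ltn_add2r.
  - by rewrite -addSn leq_add // ltnW.
have leU := leq_card_setU_shift x y A B.
move=> leS eqS; split=> [|eU]; first exact: leq_trans leU leS.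
have cS : #|shift x y A :|: shift y x B| = 'C(n, k.-1) + 'C(n.-1, k.-1).
  by apply/eqP; rewrite eqn_leq leS -eU.
have [u [v [uv sA sB]]] := eqS cS.
have eH : shift x y A :|: shift y x B = hitting k u v.
  apply/eqP; rewrite eqEcard cH // cS leqnn andbT; apply/subsetP=> F.
  rewrite in_setU => /orP[] FS; rewrite inE.
    by rewrite (shift_uniform uA FS) (sA _ FS) eqxx.
  by rewrite (shift_uniform uB FS) (sB _ FS) eqxx orbT.
have kT : k.*2 + 2 <= #|'I_n.+1| by rewrite card_ord; clear -kn; lia.
(* A k-set through [u] avoiding [v] belongs to the union but not to the star at [v], so the first
   family contains it. *)
have [|zA szA] := unshift_star k0 kT nxy uv iA uA sA.
  move=> F cF uF vF; have : F \in hitting k u v by rewrite inE cF eqxx uF.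
  by rewrite -eH in_setU => /orP[//|/sB]; rewrite (negPf vF).
have nyx : y != x by rewrite eq_sym.
have vu : v != u by rewrite eq_sym.
have [|zB szB] := unshift_star k0 kT nyx vu iB uB sB.
  move=> F cF vF uF; have : F \in hitting k u v by rewrite inE cF eqxx vF orbT.
  by rewrite -eH in_setU => /orP[/sA|//]; rewrite (negPf uF).
exists zA, zB; split=> //; apply/negP=> /eqP ezz; subst zB.
have : #|A :|: B| <= #|[set F : {set 'I_n.+1} | (#|F| == k) && (zA \in F)]|.
  apply: subset_leq_card; apply/subsetP=> F; rewrite in_setU => /orP[] FA; rewrite inE.
    by rewrite (uA _ FA) szA ?eqxx.
  by rewrite (uB _ FA) szB ?eqxx.
rewrite card_star // card_ord /= eU -[leqRHS]addn0 leq_add2l leqNgt bin_gt0 => /negP; apply.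
by clear -kn k1; lia.
Qed.

(** * Multisets with a given support *)

Lemma singleton_intersecting (T : finType) (A : {set {set T}}) :
  intersecting_family A -> uniform 1 A -> #|A| <= 1.
Proof.
move=> iA uA; apply/card_le1_eqP => F G FA GA.
have /eqP/cards1P[x eF] := uA _ FA; have /eqP/cards1P[y eG] := uA _ GA.
have := iA _ _ FA GA; rewrite eF eG => /set0Pn[z].
by rewrite !inE => /andP[/eqP<- /eqP<-].
Qed.

(** This settles [k = 1], which lies outside the compression argument. *)
Lemma union_singletons_bound (T : finType) (A B : {set {set T}}) :
    intersecting_family A -> intersecting_family B -> uniform 1 A -> uniform 1 B ->
  #|A :|: B| <= 2 /\
  (#|A :|: B| = 2 -> exists u v, [/\ u != v, in_star A u & in_star B v]).
Proof.
move=> iA iB uA uB.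
have A1 := singleton_intersecting iA uA; have B1 := singleton_intersecting iB uB.
have AB : #|A :|: B| <= #|A| + #|B| := leq_card_setU A B.
split=> [|e2]; first by lia.
have [cA cB] : #|A| = 1 /\ #|B| = 1 by lia.
have /eqP/cards1P[F eA] := cA; have /eqP/cards1P[G eB] := cB.
have /eqP/cards1P[u eF] : #|F| = 1 by apply: uA; rewrite eA inE.
have /eqP/cards1P[v eG] : #|G| = 1 by apply: uB; rewrite eB inE.
exists u, v; split; first 1 last.
- by move=> X; rewrite eA inE => /eqP->; rewrite eF inE.
- by move=> X; rewrite eB inE => /eqP->; rewrite eG inE.
by apply/eqP=> uv; move: e2; rewrite eA eB eF eG uv setUid cards1.
Qed.

Section Multisets.

Variable T : finType.

Definition msupp (A : {mset T}%mset) : {set T} := [set i | i \in A].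

(** The type of multisets is infinite, hence a list. A multiset is produced once for each element of
    its support, hence [undup]. *)
Fixpoint multisets_of_size (K : nat) : seq {mset T}%mset :=
  if K is K'.+1 then
    undup [seq (x +` A)%mset | x <- enum T, A <- multisets_of_size K']
  else [:: mset0].

Lemma size_mset1D (x : T) (A : {mset T}%mset) : size (x +` A)%mset = (size A).+1.
Proof.
apply: (@perm_size _ _ (x :: A)); apply/allP=> y _ /=.
by rewrite !count_mem_mset mset1DE (eq_sym y).
Qed.

Lemma exists_mem_mset (A : {mset T}%mset) : 0 < size A -> exists x, x \in A.
Proof.
case eA : (enum_mset A) => [//|x s] _; exists x.
by rewrite -[x \in A]/(x \in enum_mset A) eA inE eqxx.
Qed.

Lemma mem_multisets_of_size (K : nat) (A : {mset T}%mset) :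
  (A \in multisets_of_size K) = (size A == K).
Proof.
elim: K A => [|K IHK] A /=.
  rewrite inE; apply/eqP/eqP => [->|/size0nil A0]; first by rewrite enum_mset0.
  by apply/msetP=> i; rewrite mset0E -count_mem_mset A0.
rewrite mem_undup; apply/allpairsP/eqP => [[[x B] /= [_ + ->]]|cA].
  by rewrite IHK size_mset1D => /eqP->.
have [x xA] : exists x, x \in A by apply: exists_mem_mset; rewrite cA.
exists (x, (A `\ x)%mset); split; rewrite /= ?mem_enum ?msetB1K //.
by rewrite IHK -eqSS -(size_mset1D x) msetB1K // cA.
Qed.

Lemma uniq_multisets_of_size (K : nat) : uniq (multisets_of_size K).
Proof. by case: K => //= K; apply: undup_uniq. Qed.

Definition multisets_on (K : nat) (S : {set T}) : seq {mset T}%mset :=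
  [seq A <- multisets_of_size K | msupp A == S].

(* Remove one copy of x: either x disappears from the support or it remains. *)
Lemma size_multisets_on_rec (K : nat) (S : {set T}) (x : T) : x \in S ->
  size (multisets_on K.+1 S) = size (multisets_on K (S :\ x)) + size (multisets_on K S).
Proof.
move=> xS; have inj : injective (fun A : {mset T}%mset => (x +` A)%mset).
  by move=> A B /(congr1 (fun C => (C `\ x)%mset)); rewrite !msetD1K.
rewrite -(size_map (fun A => (x +` A)%mset) (multisets_on K (S :\ x))).
rewrite -(size_map (fun A => (x +` A)%mset) (multisets_on K S)) -size_cat.
apply/perm_size/uniq_perm; first by rewrite filter_uniq // uniq_multisets_of_size.
  rewrite cat_uniq !map_inj_uniq // ?filter_uniq ?uniq_multisets_of_size //= andbT.
  apply/hasPn=> _ /mapP[A AS ->]; rewrite mem_map //; move: AS.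
  rewrite !mem_filter => /andP[/eqP eA _]; apply/negP=> /andP[/eqP eA' _].
  have : x \in S :\ x by rewrite -eA' eA.
  by rewrite !inE eqxx.
move=> A0; pose A : {mset T}%mset := A0; rewrite -[A0]/A mem_cat mem_filter.
move: A => {A0} A; rewrite mem_multisets_of_size.
apply/andP/orP => [[/eqP eA /eqP cA]|].
  have xA : x \in A by move: xS; rewrite -eA inE.
  have cB : size (A `\ x)%mset == K by rewrite -eqSS -(size_mset1D x) msetB1K // cA.
  rewrite -(msetB1K xA) !mem_map // !mem_filter !mem_multisets_of_size cB !andbT.
  have [xB|xB] := boolP (x \in (A `\ x)%mset); [right | left].
    apply/eqP/setP=> i; rewrite -eA !inE; have [->|ix] := eqVneq i x;
      first by rewrite xB xA.
    by rewrite in_msetB1 (negPf ix).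
  apply/eqP/setP=> i; rewrite -eA !inE; have [->|ix] := eqVneq i x;
    first by rewrite (negPf xB).
  by rewrite in_msetB1 (negPf ix).
case=> /mapP[B]; rewrite mem_filter mem_multisets_of_size => /andP[/eqP eB /eqP cB] ->.
  rewrite size_mset1D cB eqxx; split=> //; apply/eqP/setP=> i; rewrite !inE in_mset1D.
  by have /setP/(_ i) := eB; rewrite !inE => ->; case: eqVneq => [->|//]; rewrite xS.
rewrite size_mset1D cB eqxx; split=> //; apply/eqP/setP=> i; rewrite !inE in_mset1D.
by have /setP/(_ i) := eB; rewrite !inE => ->; case: eqVneq => [->|//]; rewrite xS.
Qed.

Lemma multisets_on0 (K : nat) : multisets_on K.+1 set0 = [::].
Proof.
have noA (A : {mset T}%mset) : A \notin multisets_on K.+1 set0.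
  rewrite mem_filter mem_multisets_of_size; apply/negP=> /andP[/eqP/setP A0 /eqP cA].
  have [|x xA] := @exists_mem_mset A; first by rewrite cA.
  by have := A0 x; rewrite !inE xA.
by case: (multisets_on _ _) noA => // A s /(_ A); rewrite inE eqxx.
Qed.

(** The recursion on one removed copy becomes Pascal's rule. Empty support is set apart because the
    truncated [#|S|.-1] would wrongly give 'C(K, 0) = 1. *)
Lemma size_multisets_on (K : nat) (S : {set T}) :
  size (multisets_on K.+1 S) = if S == set0 then 0 else 'C(K, #|S|.-1).
Proof.
have base R : size (multisets_on 0 R) = (R == set0).
  rewrite /multisets_on /= (_ : msupp mset0 = set0); first by rewrite eq_sym; case: eqP.
  by apply/setP=> i; rewrite !inE in_mset0.
elim: K S => [|K IHK] S; have [->|[x xS]] := set_0Vmem S.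
- by rewrite eqxx multisets_on0.
- have S0 : S == set0 = false by apply/negbTE/set0Pn; exists x.
  rewrite (size_multisets_on_rec _ xS) !base S0 addn0 -cards_eq0.
  by rewrite (cardsD1 x S) xS add1n /=; case: #|_|.
- by rewrite eqxx multisets_on0.
have S0 : S == set0 = false by apply/negbTE/set0Pn; exists x.
rewrite (size_multisets_on_rec _ xS) !IHK S0 -cards_eq0 (cardsD1 x S) xS add1n /=.
by case: #|_| => [|c] //=; rewrite ?bin0 // binS addnC.
Qed.

Variables (U : finType) (h : T -> U).
Hypothesis h_inj : injective h.

(** Such a set is [h @: S] together with k-|S| of the k-1 points outside the image of [h]; symmetry
    of binomials gives the stated form. For empty [S] those k-1 points are too few. *)
Lemma card_sets_with_trace (k : nat) (S : {set T}) : 0 < k -> #|U| = #|T| + k.-1 ->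
  #|[set X : {set U} | (#|X| == k) && (h @^-1: X == S)]|
    = if S == set0 then 0 else 'C(k.-1, #|S|.-1).
Proof.
move=> k0 cU; pose E := h @: S :|: ~: (h @: setT).
have hS : h @: S \subset E by apply: subsetUl.
have cS : #|h @: S| = #|S| by rewrite card_imset.
have cT : #|h @: setT| = #|T| by rewrite card_imset // cardsT.
have cE : #|E| - #|h @: S| = k.-1.
  rewrite cardsU (_ : _ :&: _ = set0) ?cards0 ?subn0; last first.
    apply/setP=> i; rewrite !inE; apply/negP=> /andP[/imsetP[j _ ->]].
    by rewrite mem_imset // inE.
  by rewrite addKn cardsCs setCK cT cU addKn.
have eX : [set X : {set U} | (#|X| == k) && (h @^-1: X == S)] =
    [set X : {set U} | [&& h @: S \subset X, X \subset E & #|X| == k]].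
  apply/setP=> X; rewrite !inE andbC andbA; congr (_ && _).
  apply/eqP/andP => [eS|[/subsetP h1 /subsetP h2]].
    split; apply/subsetP=> i; first by case/imsetP=> j; rewrite -eS inE => ? ->.
    move=> iX; rewrite !inE; case: (boolP (i \in h @: setT)) => [/imsetP[j _ e]|];
      last by rewrite orbT.
    by apply/orP; left; apply/imsetP; exists j; rewrite // -eS inE -e.
  apply/setP=> i; rewrite inE; apply/idP/idP => [/h2|iS]; last by rewrite h1 // mem_imset.
  by rewrite !inE !mem_imset // inE orbF.
rewrite eX; have [Sk|kS] := leqP #|S| k.
  have cSk : #|h @: S| <= k by rewrite cS.
  rewrite card_set_interval // cE cS; have [->|S0] := eqVneq S set0.
    by rewrite cards0 subn0 bin_small ?prednK.
  have S0' : 0 < #|S| by rewrite card_gt0.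
  rewrite -bin_sub; last by lia.
  by congr 'C(_, _); lia.
rewrite (_ : [set X : {set U} | _] = set0) ?cards0; last first.
  apply/setP=> X; rewrite !inE; apply/negP=> /and3P[/subset_leq_card + _ /eqP cX].
  by rewrite cS cX leqNgt kS.
case: eqP => // _; rewrite bin_small //; lia.
Qed.

Lemma count_multisets_by_support (k : nat) (P : pred {set T}) :
    0 < k -> #|U| = #|T| + k.-1 ->
  count (fun A => P (msupp A)) (multisets_of_size k) =
  #|[set X : {set U} | (#|X| == k) && P (h @^-1: X)]|.
Proof.
move=> k0 cU; rewrite -sum1_count -sum1dep_card.
rewrite (partition_big msupp P) //= [RHS](partition_big (fun X : {set U} => h @^-1: X :
  {set T}) P) /=; last by move=> X /andP[].
apply: eq_bigr => S PS.
transitivity (size (multisets_on k S)).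
  rewrite size_filter -sum1_count; apply: eq_bigl => A.
  by case: eqP => [->|]; rewrite ?PS ?andbF.
case: k k0 cU => // k _ cU; rewrite size_multisets_on -(@card_sets_with_trace k.+1) //.
rewrite sum1dep_card; apply: eq_card => X; rewrite !inE -andbA.
by case: (h @^-1: X =P S) => [->|]; rewrite ?PS ?andbF.
Qed.

End Multisets.

(** * The golden ratio condition *)

Section GoldenRatio.
Import Order.TTheory GRing.Theory Num.Theory.
Local Open Scope ring_scope.

(** With s = m-1 the hypothesis reads sqrt 5 k < 2s-k; squaring it gives the integer inequality. *)
Lemma golden_ratio_nat (R : rcfType) (k m : nat) :
  m%:R > 1 / 2 * (1 + Num.sqrt 5) * k%:R + 1 :> R -> (m.-1 * k + k * k < m.-1 * m.-1)%N.
Proof.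
move=> h; have s5 : (Num.sqrt 5 : R) ^+ 2 = 5 by rewrite sqr_sqrtr.
have s0 : 0 <= (Num.sqrt 5 : R) by apply: sqrtr_ge0.
have k0 : 0 <= k%:R :> R by apply: ler0n.
case: m h => [|s]; first by rewrite mulr0n; nra.
move=> h; have es : s.+1%:R = s%:R + 1 :> R by rewrite -natr1.
rewrite es in h; rewrite -(ltr_nat R) natrD !natrM /=.
have h1 : Num.sqrt 5 * k%:R < 2 * s%:R - k%:R :> R by lra.
have h0 : 0 <= Num.sqrt 5 * k%:R :> R by apply: mulr_ge0.
have : (Num.sqrt 5 * k%:R) ^+ 2 < (2 * s%:R - k%:R) ^+ 2 :> R.
  by rewrite ltr_sqr // ?nnegrE //; lra.
rewrite exprMn s5; lra.
Qed.

End GoldenRatio.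

(** For n = s+k-1 this is the numerical hypothesis of [shifted_pair_bound]. The two sides differ by
    (s^2-sk-k^2) + 2(2k-s) - 1: if s < 2k, the middle term absorbs the -1, and otherwise the
    quadratic term dominates. *)
Lemma golden_ratio_arith (k s : nat) : 1 < k -> s * k + k * k < s * s ->
  [/\ k.+2 <= s & k.-1 * (s + k - 3) < (s - 2) * (s - 1)].
Proof.
move=> k1 h; have ks : k.+2 <= s by nia.
split=> //; case: (leqP (2 * k) s) => [sk|sk].
  have [t et] : exists t, s = 2 * k + t by exists (s - 2 * k); lia.
  subst s; case: k k1 {h ks sk} => [//|[//|k]] _ /=; nia.
have [t et] : exists t, s = t.+2 by exists s.-2; lia.
subst s; case: k k1 h ks sk => [//|[//|k]] _ /= h ks sk.
have -> : t.+2 + k.+2 - 3 = t + k.+1 by lia.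
have -> : t.+2 - 2 = t by lia.
have -> : t.+2 - 1 = t.+1 by lia.
nia.
Qed.

(** * Transport from multisets to sets *)

Lemma msetI_neq0P (T : finType) (A B : {mset T}%mset) :
  reflect (exists2 i, i \in A & i \in B) ((A `&` B)%mset != mset0).
Proof.
apply: (iffP idP) => [n0|[i iA iB]]; last first.
  have : i \in (A `&` B)%mset by rewrite in_msetI iA.
  by apply: contraTneq => ->; rewrite in_mset0.
have [i] : exists i, i \in (A `&` B)%mset; last by rewrite in_msetI => /andP[]; exists i.
apply: exists_mem_mset; rewrite lt0n -mem_multisets_of_size.
by rewrite inE.
Qed.

Section Transport.

Variables (k m : nat).
Hypotheses (k_gt0 : 0 < k) (m_gt1 : 1 < m).
Let N := (m + k - 2).+1.

Lemma transport_leq : m <= N.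
Proof. by rewrite /N; lia. Qed.

Definition inj_ord (i : 'I_m) : 'I_N := widen_ord transport_leq i.

Lemma inj_ord_inj : injective inj_ord.
Proof. by move=> i j [] /val_inj. Qed.

Lemma card_transport : #|'I_N| = #|'I_m| + k.-1.
Proof. by rewrite !card_ord /N; lia. Qed.

(* The k-subsets of 'I_N whose trace on 'I_m is the support of a member of F. *)
Definition transport (F : {fset {mset 'I_m}%mset}%fset) : {set {set 'I_N}} :=
  [set X : {set 'I_N} | (#|X| == k) && (inj_ord @^-1: X \in [seq msupp A | A <- enum_fset
    F])].

Lemma transport_uniform F : uniform k (transport F).
Proof. by move=> X; rewrite inE => /andP[/eqP]. Qed.

(** Traces are supports, so the common point can be taken in the image of ['I_m]. This is stronger
    than intersection and later locates the centres of stars. *)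
Lemma transport_traces_meet F X Y : intersecting F ->
  X \in transport F -> Y \in transport F -> exists i, inj_ord i \in X :&: Y.
Proof.
move=> iF; rewrite !inE => /andP[_ /mapP[A AF eA]] /andP[_ /mapP[B BF eB]].
have /msetI_neq0P[i iA iB] := iF A B AF BF; exists i; rewrite inE.
by have /setP/(_ i) := eA; have /setP/(_ i) := eB; rewrite !inE iA iB => -> ->.
Qed.

Lemma transport_intersecting F : intersecting F -> intersecting_family (transport F).
Proof.
move=> iF X Y XF YF; have [i iXY] := transport_traces_meet iF XF YF.
by apply/set0Pn; exists (inj_ord i).
Qed.

(** The right side counts all k-multisets sharing their support with some member of the union, so it
    can only be larger. *)
Lemma leq_card_transport (F1 F2 : {fset {mset 'I_m}%mset}%fset) :
    kmultiset_family k F1 -> kmultiset_family k F2 ->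
  #|` F1 `|` F2|%fset <= #|transport F1 :|: transport F2|.
Proof.
move=> hF1 hF2; pose P S := S \in [seq msupp A | A <- enum_fset (F1 `|` F2)%fset].
have -> : transport F1 :|: transport F2 =
  [set X : {set 'I_N} | (#|X| == k) && P (inj_ord @^-1: X)].
  apply/setP=> X; rewrite !inE -andb_orr; congr (_ && _); rewrite /P.
  apply/orP/mapP => [[]/mapP[A AF ->]|[A]]; try by exists A; rewrite // inE AF ?orbT.
  by rewrite inE => /orP[] AF ->; [left | right]; apply/mapP; exists A.
rewrite -(count_multisets_by_support inj_ord_inj P k_gt0 card_transport).
rewrite -size_filter; apply: uniq_leq_size; first exact: fset_uniq.
move=> A AF; rewrite mem_filter mem_multisets_of_size /P map_f //=.
by move: AF; rewrite inE => /orP[/hF1|/hF2].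
Qed.

Lemma size_multisets_hitting (x y : 'I_m) : x != y ->
  size [seq A <- multisets_of_size 'I_m k | (x \in A) || (y \in A)]
    = 'C(m + k - 2, k.-1) + 'C((m + k - 2).-1, k.-1).
Proof.
move=> xy; rewrite size_filter.
rewrite (@eq_count _ _ (fun A => [pred S : {set 'I_m} | (x \in S) || (y \in S)] (msupp
  A))); last first.
  by move=> A; rewrite /= !inE.
rewrite (count_multisets_by_support inj_ord_inj _ k_gt0 card_transport).
rewrite -[RHS](_ : #|hitting k (inj_ord x) (inj_ord y)| = _).
  by apply: eq_card => X; rewrite !inE.
by rewrite card_hitting ?(inj_eq inj_ord_inj) // card_ord.
Qed.

(** Two k-sets through [u] that share only [u] have traces that meet, so [u] itself comes from
    ['I_m]. *)
Lemma star_vertex_in_range (u v : 'I_N) (F : {fset {mset 'I_m}%mset}%fset) :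
    k.*2 <= N -> u != v -> intersecting F ->
    (forall X : {set 'I_N}, #|X| = k -> u \in X -> v \notin X -> X \in transport F) ->
  exists x, u = inj_ord x.
Proof.
move=> kN uv iF fullF.
have [||K [cK _ sK]] := @exists_avoiding 'I_N k.-1 0 set0 [:: u; v].
- by rewrite cards0.
- by rewrite card_ord /=; lia.
have [||L [cL dL sL]] := @exists_avoiding 'I_N k.-1 k.-1 K [:: u; v].
- by rewrite cK.
- by rewrite card_ord /=; lia.
have ins (M : {set 'I_N}) : #|M| = k.-1 -> {in [:: u;
  v], forall z, z \notin M} -> u |: M \in transport F.
  move=> cM sM; apply: fullF; rewrite ?setU11 //.
    by rewrite cardsU1 sM ?inE ?eqxx // cM add1n prednK.
  by rewrite !inE negb_or eq_sym uv sM // !inE eqxx orbT.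
have [i] := transport_traces_meet iF (ins K cK sK) (ins L cL sL).
rewrite !inE => /andP[/orP[/eqP<-|iK]]; first by exists i.
by rewrite (disjointFl dL iK) orbF => /eqP<-; exists i.
Qed.

End Transport.

(** * Bound and equality case for multisets *)

Lemma union_kmultisets (k m : nat) (F1 F2 : {fset {mset 'I_m}%mset}%fset) :
    0 < k -> m.-1 * k + k * k < m.-1 * m.-1 ->
    kmultiset_family k F1 -> kmultiset_family k F2 ->
    intersecting F1 -> intersecting F2 ->
  #|` F1 `|` F2|%fset <= 'C(m + k - 2, k.-1) + 'C((m + k - 2).-1, k.-1) /\
  (#|` F1 `|` F2|%fset = 'C(m + k - 2, k.-1) + 'C((m + k - 2).-1, k.-1) ->
   exists x y : 'I_m, x != y /\ forall A : {mset 'I_m}%mset, A \in (F1 `|` F2)%fset ->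
     (x \in A) || (y \in A)).
Proof.
move=> k0 gold hF1 hF2 iF1 iF2.
have m1 : 1 < m by nia.
set A1 := transport k0 m1 F1; set A2 := transport k0 m1 F2.
have iA1 : intersecting_family A1 := transport_intersecting iF1.
have iA2 : intersecting_family A2 := transport_intersecting iF2.
have uA1 : uniform k A1 := @transport_uniform _ _ k0 m1 F1.
have uA2 : uniform k A2 := @transport_uniform _ _ k0 m1 F2.
have leF := leq_card_transport k0 m1 hF1 hF2; rewrite -/A1 -/A2 in leF.
have [kN [leA eqA]] : k.*2 <= (m + k - 2).+1 /\
   #|A1 :|: A2| <= 'C(m + k - 2, k.-1) + 'C((m + k - 2).-1, k.-1) /\
  (#|A1 :|: A2| = 'C(m + k - 2, k.-1) + 'C((m + k - 2).-1, k.-1) ->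
   exists u v, [/\ u != v, in_star A1 u & in_star A2 v]).
  have [k1|k1] : k = 1 \/ 1 < k by lia.
    split; first by rewrite k1; lia.
    have -> : k.-1 = 0 by rewrite k1.
    by rewrite !bin0; apply: union_singletons_bound => // X; [move/uA1 | move/uA2] => cX;
      apply: etrans cX k1.
  have [ks num] := golden_ratio_arith k1 gold; split; first by lia.
  apply: union_intersecting_bound => //; first by lia.
  have -> : m + k - 2 - 2 = m.-1 + k - 3 by lia.
  have -> : m + k - 2 - k.+1 = m.-1 - 2 by lia.
  by have -> : m + k - 2 - k = m.-1 - 1 by lia.
split=> [|eF]; first exact: leq_trans leF leA.
have cA : #|A1 :|: A2| = 'C(m + k - 2, k.-1) + 'C((m + k - 2).-1, k.-1).
  by apply/eqP; rewrite eqn_leq leA -eF leF.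
have [u [v [uv sA1 sA2]]] := eqA cA.
have eH : A1 :|: A2 = hitting k u v.
  apply/eqP; rewrite eqEcard card_hitting // card_ord cA leqnn andbT; apply/subsetP=> X.
  rewrite in_setU => /orP[] XA; rewrite inE.
    by rewrite (uA1 _ XA) (sA1 _ XA) eqxx.
  by rewrite (uA2 _ XA) (sA2 _ XA) eqxx orbT.
have full1 (X : {set _}) : #|X| = k -> u \in X -> v \notin X -> X \in A1.
  move=> cX uX vX; have : X \in hitting k u v by rewrite inE cX eqxx uX.
  by rewrite -eH in_setU => /orP[//|/sA2]; rewrite (negPf vX).
have full2 (X : {set _}) : #|X| = k -> v \in X -> u \notin X -> X \in A2.
  move=> cX vX uX; have : X \in hitting k u v by rewrite inE cX eqxx vX orbT.
  by rewrite -eH in_setU => /orP[/sA1|//]; rewrite (negPf uX).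
have [x eu] := star_vertex_in_range kN uv iF1 full1.
have vu : v != u by rewrite eq_sym.
have [y ev] := star_vertex_in_range kN vu iF2 full2.
subst u v; exists x, y; split=> [|A AF]; first by apply: contraNneq uv => ->.
have cardA : size A == k by move: AF; rewrite inE => /orP[/hF1|/hF2].
(* [A] itself witnesses that its support is counted, so some k-set [X] has this support as its
   trace. [X] lies in the transported union and hence contains one of the two centres. *)
have : 0 < count (fun B => pred1 (msupp A) (msupp B)) (multisets_of_size 'I_m k).
  by rewrite -has_count; apply/hasP; exists A; rewrite ?mem_multisets_of_size //= eqxx.
rewrite (count_multisets_by_support (inj_ord_inj (k_gt0:=k0)
  (m_gt1:=m1)) _ k0 (card_transport k0 m1)).
rewrite card_gt0 => /set0Pn[X]; rewrite inE => /andP[cX /= /eqP eX].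
have : X \in A1 :|: A2.
  move: AF; rewrite in_setU !inE cX eX => /orP[] AF; apply/orP; [left | right];
    by apply/mapP; exists A.
rewrite eH inE cX /= => hX.
by move/setP: eX => eX; have := eX x; have := eX y; rewrite !inE => <- <-.
Qed.

Theorem theorem3p5 (R : rcfType) (k m : nat) (hk : (0 < k)%N) (hm : (0 < m)%N)
  (F1 F2 : {fset {mset 'I_m}%mset}%fset)
  (hF1 : kmultiset_family k F1) (hF2 : kmultiset_family k F2)
  (iF1 : intersecting F1) (iF2 : intersecting F2)
  (hmk : (m%:R > 1 / 2 * (1 + Num.sqrt 5) * k%:R + 1 :> R)%R) :
  (#|` F1 `|` F2|%fset <= 'C(m + k - 2, k - 1) + 'C(m + k - 3, k - 1))%N
  /\ (#|` F1 `|` F2|%fset = ('C(m + k - 2, k - 1) + 'C(m + k - 3, k - 1))%N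
      <-> exists x y : 'I_m, x != y /\
            forall A : {mset 'I_m}%mset,
              (A \in (F1 `|` F2)%fset)
              <-> kmultiset k A /\ (A `&` [mset x; y])%mset != mset0).
Proof.
have gold := golden_ratio_nat hmk; have m1 : 1 < m by nia.
have [] := union_kmultisets hk gold hF1 hF2 iF1 iF2.
rewrite -!subn1 -subnDA => leF eqF; split=> //.
have hitE x y (A : {mset 'I_m}%mset) :
    (A `&` [mset x; y])%mset != mset0 <-> (x \in A) || (y \in A).
  split=> [/msetI_neq0P[i iA]|/orP[] iA]; last 2 first.
  - by apply/msetI_neq0P; exists x; rewrite // in_mset2 eqxx.
  - by apply/msetI_neq0P; exists y; rewrite // in_mset2 eqxx orbT.
  by rewrite in_mset2 => /orP[] /eqP<-; rewrite iA ?orbT.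
have sizeH x y : x != y ->
    size [seq A <- multisets_of_size 'I_m k | (x \in A) || (y \in A)]
      = 'C(m + k - 2, k - 1) + 'C(m + k - 3, k - 1).
  by move=> xy; rewrite (size_multisets_hitting hk m1 xy) -!subn1 -subnDA.
split=> [eF|[x [y [xy FE]]]].
  have [x [y [xy hits]]] := eqF eF; exists x, y; split=> // A.
  have subH : {subset (F1 `|` F2)%fset <=
      [seq A <- multisets_of_size 'I_m k | (x \in A) || (y \in A)]}.
    move=> B BF; rewrite mem_filter mem_multisets_of_size hits //=.
    by move: BF; rewrite inE => /orP[/hF1|/hF2].
  (* Equal sizes turn the inclusion into the list of hitting k-multisets into equality. *)
  have [|_ memE] := uniq_min_size (fset_uniq _) subH; first by rewrite sizeH // eF.
  rewrite memE mem_filter mem_multisets_of_size hitE; split.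
    by case/andP.
  by case=> cA ->.
rewrite -(sizeH x y xy); apply/eqP; rewrite -uniq_size_uniq ?fset_uniq //.
  by rewrite filter_uniq // uniq_multisets_of_size.
move=> A; rewrite mem_filter mem_multisets_of_size; apply/andP/idP.
  by case=> /hitE hA cA; apply/FE.
by move/FE=> [cA /hitE].
Qed.
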